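(* Suppose a finitely generated group $G$ acts on a $\delta$-hyperbolic space $X$, and $G$ is not virtually cyclic. Let $D(\epsilon)$ be a function for WPD. Assume that there exists a constant $M$ such that for any finite generating set $S$ of $G$, the set $S^M$ contains a hyperbolic element on $X$ that is $D$-WPD. Assume that $G$ is equationally Noetherian. Then $\xi(G)$ is a well-ordered set.
   Context: Conventions. Groups act by isometries; $\delta>0$. A $\delta$-hyperbolic space is a geodesic space that is $\delta$-hyperbolic in the sense of Gromov; by the paper's convention it is taken to be a connected graph with unit-length edges, acted on by graph automorphisms, so that infima such as $L(g)$ below are attained. Distance is written $|x-y|$. Growth. Generating sets are always symmetric, $S=S^{-1}$. $S^n=B_n(G,S)$ is the set of elements of $G$ of word length at most $n$ with respect to $S$, $e(G,S)=\lim_{n\to\infty}|B_n(G,S)|^{1/n}$, and $\xi(G)=\{e(G,S) : S \text{ a finite generating set of } G\}\subset\mathbb{R}$. Well-ordered refers to the usual order of $\mathbb{R}$. Hyperbolic isometries and axes. For $g\in G$ put $L(g)=\inf_{x\in X}|x-g(x)|$ and $\lambda(g)=\lim_{n\to\infty}|x-g^n(x)|/n$ (independent of $x$). The element $g$ is hyperbolic (on $X$) if $\lambda(g)>0$. A $10\delta$-axis of a hyperbolic $g$ is the bi-infinite path obtained as follows: if $L(g)\ge10\delta$, take a point $x$ where $L(g)$ is attained and let the axis be the union of the $\langle g\rangle$-translates of a geodesic $[x,g(x)]$; if $L(g)<10\delta$, take $n>0$ with $L(g^n)\ge10\delta$ and apply this construction to $g^n$. For any two points $x,y$ on a $10\delta$-axis,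 the Hausdorff distance between the part of the axis between $x,y$ and a geodesic $[x,y]$ is at most $10\delta$. WPD. A function for WPD is a function $D$ assigning to each $\epsilon>0$ a number $D(\epsilon)>0$, assumed without loss of generality to be non-decreasing and to satisfy $D(100\delta)\ge50$. A hyperbolic element $g\in G$ is $D$-WPD if there is a $10\delta$-axis $\gamma$ of $g$ such that for any $\epsilon>0$ and any $x,y\in\gamma$ with $|x-y|\ge D(\epsilon)\lambda(g)$, the set $\{h\in G : |h(x)-x|\le\epsilon,\ |h(y)-y|\le\epsilon\}$ has at most $D(\epsilon)$ elements. Equationally Noetherian. For a subset $S$ of the free group $F(x_1,\dots,x_\ell)$ let $V_G(S)=\{(g_1,\dots,g_\ell)\in G^\ell : s(g_1,\dots,g_\ell)=1 \text{ for all } s\in S\}$. $G$ is equationally Noetherian if for every $\ell\ge1$ and every subset $S\subset F(x_1,\dots,x_\ell)$ there is a finite subset $S_0\subset S$ with $V_G(S_0)=V_G(S)$. *)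

(* Defs.v *)
From mathcomp Require Import all_boot all_order all_algebra.
From mathcomp Require Import finmap.
From mathcomp Require Import all_classical all_reals all_analysis.

Set Implicit Arguments.
Unset Strict Implicit.
Unset Printing Implicit Defensive.

Import Order.TTheory GRing.Theory Num.Theory.
Import numFieldTopology.Exports numFieldNormedType.Exports.

Local Open Scope classical_set_scope.
Local Open Scope ring_scope.

(** * Finitely generated groups and their growth *)

Section Groups.
Context {G : groupType}.
Implicit Types (S : set G) (n : nat) (g z : G).

(* The elements of word length at most n; S is assumed symmetric below, so
   inverses of letters are not needed. *)
Definition word_ball S n : set G :=
  [set g | exists s : seq G,
     [/\ (size s <= n)%N, {in s, forall a, S a} & g = (\prod_(a <- s) a)%g]].

Definition finite_generating_set S : Prop :=
  [/\ finite_set S, forall a, S a -> S (a^-1)%g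
    & forall g, exists n, word_ball S n g].

Definition finitely_generated : Prop := exists S, finite_generating_set S.

Definition cyclic_subgroup z : set G :=
  [set g | exists n, g = (z ^+ n)%g \/ g = (z ^- n)%g].

(* Some cyclic subgroup has finite index: finitely many of its left cosets
   cover G.  Finite groups are included. *)
Definition virtually_cyclic : Prop :=
  exists (z : G) (T : set G), finite_set T /\
    forall g, exists2 t, T t & cyclic_subgroup z (t^-1 * g)%g.

Context (R : realType).

(* The limit exists for finite S, by submultiplicativity of the cardinals. *)
Definition growth_rate S : R :=
  limn (fun n => (#|` fset_set (word_ball S n)|%:R : R) `^ (n%:R^-1)).

Definition growth_rates : set R := growth_rate @` finite_generating_set.

End Groups.

Arguments finitely_generated : clear implicits.
Arguments virtually_cyclic : clear implicits.
Arguments growth_rates : clear implicits.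

(** * Equationally Noetherian groups *)

(* The letter (i, true) stands for x_i and (i, false) for its inverse; the
   free group is the set of reduced words. *)
Definition reduced_word (l : nat) (w : seq ('I_l * bool)) : bool :=
  sorted (fun a b => ~~ ((a.1 == b.1) && (a.2 != b.2))) w.

Definition free_group (l : nat) : Type :=
  {w : seq ('I_l * bool) | reduced_word w}.

Definition eval_word (G : groupType) (l : nat) (w : free_group l)
    (g : l.-tuple G) : G :=
  (\prod_(a <- sval w) (if a.2 then tnth g a.1 else (tnth g a.1)^-1))%g.

Definition solution_set (G : groupType) (l : nat) (S : set (free_group l)) :
    set (l.-tuple G) :=
  [set g | forall s, S s -> eval_word s g = 1%g].

Arguments solution_set : clear implicits.

Definition equationally_noetherian (G : groupType) : Prop :=
  forall l : nat, (0 < l)%N -> forall S : set (free_group l),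
    exists S0 : set (free_group l),
      [/\ finite_set S0, S0 `<=` S & solution_set G l S0 = solution_set G l S].

(** * Hyperbolic spaces *)

Section Metric.
Context {R : realType} {X : metricType R}.
Implicit Types (x y z w : X) (c : R -> X) (delta : R).

Definition geodesic_segment x y c : Prop :=
  [/\ c 0 = x, c (mdist x y) = y &
      {in `[0, mdist x y] &, forall s t, mdist (c s) (c t) = `|s - t|}].

Definition gromov_product w x y : R :=
  (mdist x w + mdist y w - mdist x y) / 2.

Definition gromov_hyperbolic delta : Prop :=
  (forall x y, exists c, geodesic_segment x y c) /\
  (forall w x y z,
     Num.min (gromov_product w x y) (gromov_product w y z) - delta
       <= gromov_product w x z).

End Metric.

Arguments gromov_hyperbolic {R} X delta.

(** * Metric graphs *)

(* Graphs in the sense of Serre, so that loops and multiple edges are allowed: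
   every geometric edge is a pair {e, rev e} of oriented ones. *)
Record graph := Graph {
  vertex : Type;
  edge : Type;
  src : edge -> vertex;
  rev : edge -> edge;
  revK : involutive rev;
  rev_neq : forall e, rev e <> e }.

Definition tgt (Gam : graph) (e : edge Gam) : vertex Gam := src (rev e).

Fixpoint walk (Gam : graph) (n : nat) (u v : vertex Gam) : Prop :=
  if n is m.+1 then exists2 e, src e = u & walk m (tgt e) v else u = v.

Definition connected_graph (Gam : graph) : Prop :=
  forall u v : vertex Gam, exists n, walk n u v.

Section Realization.
Context (R : realType) (Gam : graph).

(* EdgePt e t lies at distance t from src e along e.  A point of the geometric
   realization may have several representatives, at pt_dist 0 of each other. *)
Inductive graph_pt :=
| VertPt (v : vertex Gam)
| EdgePt (e : edge Gam) (t : {t : R | 0 <= t <= 1}).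

(* u is an end, at distance a along the edge, of the edge containing p. *)
Definition leg (p : graph_pt) (u : vertex Gam) (a : R) : Prop :=
  match p with
  | VertPt v => u = v /\ a = 0
  | EdgePt e t => (u = src e /\ a = sval t) \/ (u = tgt e /\ a = 1 - sval t)
  end.

Definition along_edge (p q : graph_pt) (r : R) : Prop :=
  match p, q with
  | EdgePt e s, EdgePt f t =>
      (f = e /\ r = `|sval s - sval t|) \/
      (f = rev e /\ r = `|sval s - (1 - sval t)|)
  | _, _ => False
  end.

Definition through_vertices (p q : graph_pt) (r : R) : Prop :=
  exists u v a b n,
    [/\ leg p u a, leg q v b, walk n u v & r = a + n%:R + b].

(* The path metric of the realization with edges of length 1. *)
Definition pt_dist (p q : graph_pt) : R :=
  inf [set r | along_edge p q r \/ through_vertices p q r].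

Definition is_realization (X : metricType R) (phi : graph_pt -> X) : Prop :=
  (forall x, exists p, phi p = x) /\
  (forall p q, mdist (phi p) (phi q) = pt_dist p q).

Definition graph_automorphism (fV : vertex Gam -> vertex Gam)
    (fE : edge Gam -> edge Gam) : Prop :=
  [/\ bijective fV, bijective fE, forall e, src (fE e) = fV (src e)
    & forall e, fE (rev e) = rev (fE e)].

Definition map_pt (fV : vertex Gam -> vertex Gam) (fE : edge Gam -> edge Gam)
    (p : graph_pt) : graph_pt :=
  match p with
  | VertPt v => VertPt (fV v)
  | EdgePt e t => EdgePt (fE e) t
  end.

End Realization.

(** * Isometric actions, axes and WPD elements *)

Section Actions.
Context {R : realType} {X : metricType R} {G : groupType}.
Variable act : G -> X -> X.
Implicit Types (g h : G) (x y : X) (gam : set X).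

Definition isometric_action : Prop :=
  [/\ forall x, act 1%g x = x,
      forall g h x, act (g * h)%g x = act g (act h x)
    & forall g x y, mdist (act g x) (act g y) = mdist x y].

(* X is a connected graph with edges of length 1, on which G acts by graph
   automorphisms. *)
Definition acts_on_metric_graph : Prop :=
  exists (Gam : graph) (phi : graph_pt R Gam -> X),
    [/\ connected_graph Gam, is_realization phi
      & forall g, exists fV fE, graph_automorphism fV fE /\
          forall p, act g (phi p) = phi (map_pt fV fE p)].

(* L(g) *)
Definition displacement g : R := inf (range (fun x => mdist x (act g x))).

(* lambda(g): the common value, for all x, of lim |x - g^n x| / n; it exists
   and is unique for an isometric action on a nonempty space. *)
Definition translation_length g : R :=
  xget 0 [set l : R | forall x,
    (fun n => mdist x (act (g ^+ n)%g x) / n%:R) @ \oo --> l].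

Definition hyperbolic_elt g : Prop := 0 < translation_length g.

(* The union of the <h>-translates of a geodesic [x, h x], where x realizes
   L(h). *)
Definition geodesic_orbit h gam : Prop :=
  exists x c,
    [/\ mdist x (act h x) = displacement h, geodesic_segment x (act h x) c
      & gam = [set y | exists k t, [/\ cyclic_subgroup h k,
                 t \in `[0, displacement h] & y = act k (c t)]]].

(* The 10 delta-axes of g, as subsets of X. *)
Definition is_axis (delta : R) g gam : Prop :=
  (10 * delta <= displacement g /\ geodesic_orbit g gam) \/
  (displacement g < 10 * delta /\
   exists n, [/\ (0 < n)%N, 10 * delta <= displacement (g ^+ n)%g
               & geodesic_orbit (g ^+ n)%g gam]).

Definition wpd_function (delta : R) (D : R -> R) : Prop :=
  [/\ forall eps, 0 < eps -> 0 < D eps,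
      forall eps eps', 0 < eps -> eps <= eps' -> D eps <= D eps'
    & 50 <= D (100 * delta)].

Definition wpd_elt (delta : R) (D : R -> R) g : Prop :=
  hyperbolic_elt g /\
  exists2 gam, is_axis delta g gam &
    forall eps, 0 < eps -> forall x y, gam x -> gam y ->
      D eps * translation_length g <= mdist x y ->
      let A := [set h | mdist (act h x) x <= eps /\
                        mdist (act h y) y <= eps] in
      finite_set A /\ #|` fset_set A|%:R <= D eps.

End Actions.

(* Main.v *)
(* The heart of the proof is the inequality
       |B_m| |B_n| <= C (20 m + 1) |B_(m+n+b)|
   between the sizes of the balls of a finite generating set S, where C and b do
   not depend on S. Starting from the short WPD element one builds a word a of bounded length,
   still coarsely WPD, and a base point which a moves at least a tenth as far as
   any letter does; some letter s does not commensurate a, since G is not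
   virtually cyclic. Sending (w, w') to w u w', where u = a^(+-k) s a^(+-k) with
   signs depending on w and w', causes no cancellation, so the translate of the
   segment [1, u] by w lies along [1, w u w']. There are O(m) positions for it on
   the scale of a. Two decompositions of the same element at about the same
   position differ by an element coarsely preserving the axis of a and that of
   its u-translate; such an element commutes with powers of both, hence is
   torsion and moves the base point little, and WPD bounds their number.

   The inequality gives |B_m| <= C (20 m + 1) y^(m+b) for all y > e(G,S). For
   m = 1 this bounds |S|, so in a strictly decreasing sequence of rates e(G,S_n)
   all S_n come from tuples of a fixed size. Let K be the set of words trivial in
   almost all of these tuples, with respect to a nonprincipal ultrafilter. By the
   Noetherian property some tuple S_N satisfies all equations in K, and then for
   every m there is n > N with |B_m(S_N)| <= |B_m(S_n)|. Hence
   e(G,S_N)^m <= C (20 m + 1) y^(m+b) with y < e(G,S_N) fixed: a contradiction. *)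

Require Import Defs.
From mathcomp Require Import all_boot all_order all_algebra.
From mathcomp Require Import finmap zify lra.
From mathcomp Require Import all_classical all_reals all_analysis.
From mathcomp Require wochoice.

Set Implicit Arguments.
Unset Strict Implicit.
Unset Printing Implicit Defensive.

Import Order.TTheory GRing.Theory Num.Theory.
Import numFieldTopology.Exports numFieldNormedType.Exports.
Local Open Scope classical_set_scope.
Local Open Scope ring_scope.

(** * Hyperbolic pseudometrics *)

Section PseudoMetric.
Context {R : realFieldType} {T : Type}.
Variables (D : R) (d : T -> T -> R).

(* Twice the Gromov product of x and y at w. *)
Definition dgp (w x y : T) : R := d x w + d y w - d x y.

Local Notation gp := dgp.

(* The four-point condition is split into its two cases to make it digestible
   by [lra]. *)
Definition hyperbolic_dist : Prop :=
  [/\ forall x, d x x = 0, forall x y, d x y = d y x,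
      forall x y z, d x z <= d x y + d y z
    & forall x y z w, d x z + d y w <= d x y + d z w + D \/
                      d x z + d y w <= d x w + d y z + D].

Hypothesis d_hyp : hyperbolic_dist.
Hypothesis D_gt0 : 0 < D.

(* [lra] does not see section hypotheses. *)
Local Ltac lraD := have ? := D_gt0; lra.

Lemma distxx x : d x x = 0. Proof. by case: d_hyp. Qed.
Lemma distC x y : d x y = d y x. Proof. by case: d_hyp. Qed.
Lemma dist_tri x y z : d x z <= d x y + d y z. Proof. by case: d_hyp. Qed.
Lemma dist_4pt x y z w : d x z + d y w <= d x y + d z w + D \/
                      d x z + d y w <= d x w + d y z + D.
Proof. by case: d_hyp. Qed.

Lemma dist_ge0 x y : 0 <= d x y.
Proof. by have := dist_tri x y x; rewrite distxx (distC y x); lra. Qed.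

Lemma gpC w x y : gp w x y = gp w y x.
Proof. by rewrite /dgp (distC x y); lra. Qed.

Lemma gp_ge0 w x y : 0 <= gp w x y.
Proof. by rewrite /dgp; have := dist_tri x w y; rewrite (distC w y); lra. Qed.

Lemma gp_4pt w x y z : gp w x y <= gp w x z + D \/ gp w y z <= gp w x z + D.
Proof.
rewrite /dgp; have := dist_4pt x y z w.
by move=> [] ?; [left|right]; lra.
Qed.

Lemma gp_flip x y z : gp y x z = 2 * d x y - gp x y z.
Proof. by rewrite /dgp (distC y x) (distC z x) (distC z y); lra. Qed.

(* Two points almost on the geodesic from P to Q are determined up to a bounded
   error by their distances to P. *)
Lemma gp_near P Q z z' c r : gp z P Q <= c -> gp z' P Q <= c ->
  d P z - d P z' <= r -> d P z' - d P z <= r -> d z z' <= r + c + D.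
Proof.
rewrite /dgp (distC Q z) (distC Q z') => h1 h2 h3 h4.
by have := dist_4pt z P z' Q; rewrite (distC z P); move=> []; lra.
Qed.

(** The error does not accumulate in the induction: by [gp_flip] and the length of the step, the
    product of x_i and x_j at x_(j+1) is at least c + 3 D, so the four-point condition must take its
    other case, which bounds the product of x_i and x_(j+2) by c + D. *)
Lemma chain_left (x : nat -> T) (c : R) n : 0 <= c ->
  (forall i, (i.+1 < n)%N -> gp (x i.+1) (x i) (x i.+2) <= c) ->
  (forall i, (i < n)%N -> c + 2 * D <= d (x i) (x i.+1)) ->
  forall i j, (i < j)%N -> (j < n)%N -> gp (x j) (x i) (x j.+1) <= c + D.
Proof.
move=> c_ge0 turn len i j; elim: j => // j IH ij jn.
have := turn j jn.
move: ij; rewrite ltnS leq_eqVlt => /orP[/eqP ->|ij] h; first by lraD.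
have {}IH := IH ij (ltnW jn).
have lj := len j (ltnW jn).
have := gp_4pt (x j.+1) (x j) (x i) (x j.+2).
by rewrite (gp_flip (x j) _ (x i)) (gpC (x j)); move=> []; lraD.
Qed.

(** Local-to-global principle: [chain_left] is used on the chain and on its reversal, and the two
    bounds are joined at x_j across the step to x_(j+1). *)
Lemma chain_gp (x : nat -> T) (c : R) n : 0 <= c ->
  (forall i, (i.+1 < n)%N -> gp (x i.+1) (x i) (x i.+2) <= c) ->
  (forall i, (i < n)%N -> c + 2 * D <= d (x i) (x i.+1)) ->
  forall i j k, (i <= j)%N -> (j <= k)%N -> (k <= n)%N ->
  gp (x j) (x i) (x k) <= c + 2 * D.
Proof.
move=> c_ge0 turn len i j k ij jk kn.
have right_ m : (j.+1 + m <= n)%N -> gp (x j.+1) (x j) (x (j.+1 + m)%N) <= c + D.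
  move=> jm.
  pose y l := x (j.+1 + m - l)%N.
  have ye l : (l <= m.+1)%N -> y l = x (j + (m.+1 - l))%N.
    by move=> lm; rewrite /y; congr x; lia.
  have turn' l : (l.+1 < m.+1)%N -> gp (y l.+1) (y l) (y l.+2) <= c.
    move=> lm; rewrite gpC !ye; [|lia..].
    have -> : (j + (m.+1 - l.+1) = (j + (m.+1 - l.+2)).+1)%N by lia.
    have -> : (j + (m.+1 - l) = (j + (m.+1 - l.+2)).+2)%N by lia.
    by apply: turn; lia.
  have len' l : (l < m.+1)%N -> c + 2 * D <= d (y l) (y l.+1).
    move=> lm; rewrite distC !ye; [|lia..].
    have -> : (j + (m.+1 - l) = (j + (m.+1 - l.+1)).+1)%N by lia.
    by apply: len; lia.
  case: m => [|m] in jm y ye turn' len' *.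
    by rewrite addn0 /dgp distxx; lraD.
  have := chain_left c_ge0 turn' len' (i := 0%N) (j := m.+1).
  rewrite !ye; [|lia..]; rewrite subn0 subnn addn0.
  have -> : (m.+2 - m.+1 = 1)%N by lia.
  rewrite addn1 gpC => H.
  have -> : (j.+1 + m.+1 = j + m.+2)%N by lia.
  by apply: H.
have [->|ij'] := eqVneq i j.
  by rewrite /dgp distxx (distC (x k)); lraD.
have [->|jk'] := eqVneq j k.
  by rewrite /dgp distxx; lraD.
have {}ij : (i < j)%N by rewrite ltn_neqAle ij'.
have {}jk : (j < k)%N by rewrite ltn_neqAle jk'.
have jn : (j < n)%N by apply: leq_trans kn.
have L := chain_left c_ge0 turn len ij jn.
have := right_ (k - j.+1)%N; rewrite subnKC // => /(_ kn) Rt.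
have := gp_4pt (x j) (x i) (x k) (x j.+1).
have lj := len j jn.
by rewrite (gpC _ (x k)) (gp_flip (x j.+1)) (distC (x j.+1)); move=> []; lraD.
Qed.

(** With P, w, y, z, Q in this order along a path, the backtracking at w, y and z adds up, by the
    triangle inequality alone. *)
Lemma gp_nest P Q w z y : gp y P Q <= gp y w z + gp w P z + gp z P Q.
Proof.
by have := dist_tri P w y; have := dist_tri Q z y; rewrite /dgp (distC z w); lra.
Qed.

(** Seen from the distant point f, P and P' have a large product, and so have Q and Q'; each
    replacement in the four-point condition costs D. *)
Lemma gp_move P Q P' Q' f c C : gp f P' Q' <= c -> d P P' <= C -> d Q Q' <= C ->
  C + c + 2 * D < d f P -> C + c + 2 * D < d f Q -> gp f P Q <= c + 2 * D.
Proof.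
move=> h hP hQ fP fQ.
have := gp_ge0 f P' Q'; have := gp_4pt f P' P Q'; have := gp_4pt f P Q Q'.
have := dist_tri f P' P; have := dist_tri f Q' Q.
move: h fP fQ; rewrite /dgp !(distC _ f) (distC P' P) (distC Q' Q).
by move=> ? ? ? ? ? [] ? [] ? ?; lraD.
Qed.

(** The difference d P y - d P y' behaves like that of a Busemann function: moving the distant point
    P to P' lowers it by at most D, however large C is. *)
Lemma dist_shift P P' y y' C : d P P' <= C ->
  C + d y y' + D < d P y + d P' y' -> d P y + d P' y' <= d P y' + d P' y + D.
Proof.
by have := dist_4pt P P' y y'; move=> [] ? ? ?; lra.
Qed.

End PseudoMetric.

(** * Cardinality bounds through duplicate-free lists *)

Definition card_le (T : eqType) (A : T -> Prop) (N : nat) : Prop :=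
  forall s : seq T, uniq s -> (forall x, x \in s -> A x) -> (size s <= N)%N.

Lemma card_le_inj (T U : eqType) (A : T -> Prop) (B : U -> Prop) N (f : T -> U) :
  (forall x y, A x -> A y -> f x = f y -> x = y) ->
  (forall x, A x -> B (f x)) -> card_le B N -> card_le A N.
Proof.
move=> f_inj AB BN s us sA; rewrite -(size_map f); apply: BN.
  by rewrite map_inj_in_uniq // => x y xs ys; apply: f_inj; apply: sA.
by move=> _ /mapP[x xs ->]; apply/AB/sA.
Qed.

Lemma card_le_sub (T : eqType) (A B : T -> Prop) N :
  (forall x, A x -> B x) -> card_le B N -> card_le A N.
Proof. exact: card_le_inj. Qed.

Lemma card_le_pigeonhole (T : eqType) (A : T -> Prop) N (f : nat -> T) :
  card_le A N -> (forall j, (j <= N)%N -> A (f j)) ->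
  exists i j, [/\ (i < j)%N, (j <= N)%N & f i = f j].
Proof.
move=> AN fA; have [u|] := boolP (uniq (map f (iota 0 N.+1))).
  have := AN _ u; rewrite size_map size_iota ltnn => H; suff: false by [].
  by apply: H => x /mapP[j]; rewrite mem_iota add0n ltnS => /andP[_ jN] ->; apply: fA.
case/(uniqPn (f 0%N)) => i [j [ij]]; rewrite size_map size_iota ltnS => jN.
rewrite !(nth_map 0%N) ?size_iota ?nth_iota ?add0n; try lia.
by move=> e; exists i, j.
Qed.

Lemma card_le_fibers (T : eqType) (A : T -> Prop) N K (idx : T -> nat) :
  (forall x, A x -> (idx x < K)%N) ->
  (forall i, card_le (fun x => A x /\ idx x = i) N) -> card_le A (K * N).
Proof.
elim: K A => [|K IH] A idxK fib s us sA.
  by case: s us sA => // x s _ /(_ x (mem_head _ _)) /idxK.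
rewrite -(count_predC (fun x => idx x == K) s) mulSn -!size_filter leq_add //.
  apply: (fib K); first exact: filter_uniq.
  by move=> x; rewrite mem_filter => /andP[/eqP e /sA].
apply: (IH (fun x => A x /\ idx x != K)).
- by move=> x [/idxK]; rewrite ltnS leq_eqVlt => /orP[->|].
- by move=> i; apply: card_le_sub (fib i) => x [[? _] ?].
- exact: filter_uniq.
- by move=> x; rewrite mem_filter => /andP[? /sA].
Qed.

Lemma card_le_finite (T : choiceType) (A : T -> Prop) N :
  card_le A N -> finite_set (A : set T).
Proof.
move=> AN; apply: contrapT => /(infinite_set_fset N.+1) [B BA].
rewrite leqNgt ltnS => /negP; apply; apply: AN => // x xB; exact: BA.
Qed.

(** Left translation by the inverse of one element of A embeds A into B. This is how bounds on
    coarse stabilizers become bounds on fibers. *)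
Lemma card_le_diff (G : groupType) (A B : G -> Prop) N :
  (forall f g, A f -> A g -> B (f^-1 * g)%g) -> card_le B N -> card_le A N.
Proof.
move=> AB BN [|f s] // us sA; rewrite -(size_map (fun g => f^-1 * g)%g); apply: BN.
  by rewrite map_inj_uniq //; apply: mulgI.
by move=> _ /mapP[g gs ->]; apply: AB; apply: sA => //; apply: mem_head.
Qed.

(** * Cyclic subgroups and word balls *)

Lemma cyclic_subgroupV (G : groupType) (b x : G) :
  cyclic_subgroup b x -> cyclic_subgroup b x^-1%g.
Proof. by move=> [n [->|->]]; exists n; [right|left]; rewrite ?invgK. Qed.

Lemma cyclic_subgroupM (G : groupType) (b x y : G) :
  cyclic_subgroup b x -> cyclic_subgroup b y -> cyclic_subgroup b (x * y)%g.
Proof.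
have main i j : cyclic_subgroup b (b ^+ i * b ^- j)%g.
  case: (leqP j i) => ij.
    by exists (i - j)%N; left; rewrite -{1}(subnK ij) expgnDr mulgK.
  exists (j - i)%N; right; apply: invg_inj; rewrite invgM !invgK.
  by rewrite -{1}(subnK (ltnW ij)) expgnDr mulgK.
move=> [i [->|->]] [j [->|->]].
- by exists (i + j)%N; left; rewrite expgnDr.
- exact: main.
- have -> : (b ^- i * b ^+ j = b ^+ j * b ^- i)%g; last exact: main.
  by apply/commute_sym/commuteV/commuteX2.
- by exists (i + j)%N; right; rewrite addnC expgnDr invgM.
Qed.

Section WordBalls.
Context {G : groupType}.
Variable S : set G.
Hypothesis S_gen : finite_generating_set S.
Implicit Types (g h : G) (m n : nat).

Lemma word_ball_mul m n g h :
  word_ball S m g -> word_ball S n h -> word_ball S (m + n) (g * h)%g.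
Proof.
move=> [s [sm sS ->]] [t [tn tS ->]]; exists (s ++ t); split.
- by rewrite size_cat leq_add.
- by move=> x; rewrite mem_cat => /orP[/sS|/tS].
- by rewrite big_cat.
Qed.

Lemma word_ball_leq m n g : (m <= n)%N -> word_ball S m g -> word_ball S n g.
Proof. by move=> mn [s [sm sS ->]]; exists s; split => //; apply: leq_trans mn. Qed.

Lemma word_ball_letter g : S g -> word_ball S 1 g.
Proof.
by move=> Sg; exists [:: g]; split => //; [move=> x; rewrite inE => /eqP->|rewrite big_seq1].
Qed.

Lemma word_ball_one n : word_ball S n 1%g.
Proof. by exists [::]; split => //; rewrite big_nil. Qed.

Lemma word_ball_inv n g : word_ball S n g -> word_ball S n g^-1%g.
Proof.
have [_ SV _] := S_gen; move=> [s [sn sS ->]].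
elim: s n sn sS => [|x s IH] n sn sS.
  by rewrite big_nil invg1; apply: word_ball_one.
rewrite big_cons invgM; case: n sn => // n sn; rewrite -addn1.
apply: word_ball_mul; first by apply: IH => // y ys; apply: sS; rewrite in_cons ys orbT.
by apply/word_ball_letter/SV/sS/mem_head.
Qed.

Lemma word_ball_exp n g k : word_ball S n g -> word_ball S (k * n) (g ^+ k)%g.
Proof.
move=> ng; elim: k => [|k IH]; first by rewrite expg0; apply: word_ball_one.
by rewrite expgS mulSn; apply: word_ball_mul.
Qed.

Lemma word_ball_finite n : finite_set (word_ball S n).
Proof.
have [Sfin _ _] := S_gen; elim: n => [|n IH].
  apply: (sub_finite_set _ (finite_set1 1%g)) => g [[|x s] [//= _ _ ->]].
  by rewrite big_nil.
have fin : finite_set [set 1%g : G] by exact: finite_set1.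
apply: (sub_finite_set _
    (_ : finite_set (1%g |` [set x * y | x in S & y in word_ball S n]%g)%classic)).
  move=> g [[|x s] [sn sS ->]]; first by left; rewrite big_nil.
  right; rewrite big_cons; exists x; first by apply: sS; apply: mem_head.
  exists (\prod_(a <- s) a)%g => //; exists s; split => // y ys.
  by apply: sS; rewrite in_cons ys orbT.
by rewrite finite_setU; split => //; apply: finite_image2.
Qed.

End WordBalls.

Definition ball_size (G : groupType) (S : set G) (n : nat) : nat :=
  #|` fset_set (word_ball S n)|.
(** * Left-invariant hyperbolic distances on a group *)

Section LeftInvariant.
Context {R : realType} {G : groupType}.
Variables (D : R) (d : G -> G -> R).
Hypothesis d_hyp : hyperbolic_dist D d.
Hypothesis D_gt0 : 0 < D.
Hypothesis dL : forall g u v, d (g * u)%g (g * v)%g = d u v.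

Local Notation gp := (dgp d).
Local Ltac lraD := have ? := D_gt0; lra.
Implicit Types (a b f g h u v w : G) (N i j k l m : nat).

Let dxx := distxx d_hyp.
Let dC := distC d_hyp.
Let d_tri := dist_tri d_hyp.
Let d_ge0 := dist_ge0 d_hyp.

Lemma gpL g u v w : gp (g * u)%g (g * v)%g (g * w)%g = gp u v w.
Proof. by rewrite /dgp !dL. Qed.

Lemma distM u v : d u (u * v)%g = d 1%g v.
Proof. by rewrite -{1}(mulg1 u) dL. Qed.

Lemma len_inv u : d 1%g u^-1%g = d 1%g u.
Proof. by rewrite -(dL u) mulg1 mulgV dC. Qed.

Lemma lenM u v : d 1%g (u * v)%g <= d 1%g u + d 1%g v.
Proof. by have := d_tri 1%g u (u * v)%g; rewrite distM. Qed.

Definition coarse_stab e u v : G -> Prop :=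
  fun h => d u (h * u)%g <= e /\ d v (h * v)%g <= e.

Lemma coarse_stab_translate e N g u v : card_le (coarse_stab e u v) N ->
  card_le (coarse_stab e (g * u)%g (g * v)%g) N.
Proof.
apply: (@card_le_inj _ _ _ _ _ (fun h => g^-1 * h * g)%g).
  by move=> x y _ _ /mulIg /mulgI.
move=> h [h1 h2].
by split; rewrite -(dL g) !mulgA mulgV mul1g -!mulgA.
Qed.

Lemma coarse_stab_sym e N u v : card_le (coarse_stab e u v) N ->
  card_le (coarse_stab e v u) N.
Proof. by apply: card_le_sub => h []. Qed.

Lemma coarse_stab_le e e' N u v : e' <= e -> card_le (coarse_stab e u v) N ->
  card_le (coarse_stab e' u v) N.
Proof.
by move=> ee; apply: card_le_sub => h [h1 h2]; split; apply: le_trans ee.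
Qed.

(** Both w and g w lie near [u, v] at about the same distance from u, so [gp_near] applies. *)
Lemma coarse_stab_between e c u v w g : gp w u v <= c ->
  coarse_stab e u v g -> coarse_stab (3 * e + c + D) u w g.
Proof.
move=> h [g1 g2].
have e_ge0 : 0 <= e by apply: le_trans g1; apply: d_ge0.
have c_ge0 : 0 <= c by apply: le_trans h; apply: gp_ge0 d_hyp _ _ _.
have uw : d (g * u)%g (g * w)%g = d u w := dL _ _ _.
have wv : d (g * w)%g (g * v)%g = d w v := dL _ _ _.
have t1 := d_tri u (g * u)%g (g * w)%g.
have t2 := d_tri (g * w)%g (g * v)%g v.
have t3 := d_tri (g * u)%g u (g * w)%g.
have vgv := dC (g * v)%g v.
have ugu := dC (g * u)%g u.
split; first lraD.
have -> : 3 * e + c + D = e + (2 * e + c) + D by lra.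
apply: (gp_near d_hyp (P := u) (Q := v)); last 1 first.
- by lra.
- by lra.
- by move: h; rewrite /dgp (dC v w) (dC v (g * w)%g); lra.
by lra.
Qed.

(** * Powers of an element with little backtracking *)

Section Powers.
Variables (a : G) (c : R).
Hypothesis a_gp : gp 1%g a^-1%g a <= c.
Hypothesis a_len : c + 2 * D <= d 1%g a.

Let c_ge0 : 0 <= c. Proof. by apply: le_trans a_gp; apply: gp_ge0 d_hyp _ _ _. Qed.

Lemma pow_gp i j k : (i <= j)%N -> (j <= k)%N ->
  gp (a ^+ j)%g (a ^+ i)%g (a ^+ k)%g <= c + 2 * D.
Proof.
move=> ij jk; apply: (@chain_gp _ _ D d d_hyp D_gt0 (fun i => (a ^+ i)%g) c k) => //.
  move=> l _; rewrite -[X in gp X](mulg1 (a ^+ l.+1)%g) -(mulgK a (a ^+ l)%g) -expgSr.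
  by rewrite (expgSr a l.+1) gpL.
by move=> l _; rewrite expgSr distM.
Qed.

Lemma pow_dist i j : d (a ^+ i)%g (a ^+ (i + j))%g = d 1%g (a ^+ j)%g.
Proof. by rewrite expgnDr distM. Qed.

Lemma pow_lenD i j :
  d 1%g (a ^+ i)%g + d 1%g (a ^+ j)%g - (c + 2 * D) <= d 1%g (a ^+ (i + j))%g.
Proof.
have := @pow_gp 0 i (i + j) (leq0n _) (leq_addr _ _).
by rewrite /dgp expg0 (dC (a ^+ (i + j))%g) pow_dist; lra.
Qed.

Lemma pow_len_lower i : (d 1%g a - (c + 2 * D)) * i%:R <= d 1%g (a ^+ i)%g.
Proof.
elim: i => [|i IH]; first by rewrite mulr0 d_ge0.
by have := pow_lenD 1 i; rewrite expg1 add1n -natr1; lra.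
Qed.

Lemma pow_gp1 i : gp 1%g (a ^- i)%g (a ^+ i)%g <= c + 2 * D.
Proof.
rewrite -(gpL (a ^+ i)%g) mulgV mulg1 -expgnDr -(expg0 a).
by apply: pow_gp => //; apply: leq_addr.
Qed.

End Powers.

Lemma pow_len_upper a i : d 1%g (a ^+ i)%g <= d 1%g a * i%:R.
Proof.
elim: i => [|i IH]; first by rewrite mulr0 expg0 dxx.
by have := lenM a (a ^+ i)%g; rewrite -expgS -natr1; lra.
Qed.

Lemma len_expV a i : d 1%g (a^-1 ^+ i)%g = d 1%g (a ^+ i)%g.
Proof. by rewrite expVgn len_inv. Qed.

(** The directions of a and a^-1 diverge at 1, so y cannot follow both. Choosing signs by this lemma
    is what prevents cancellation later. *)
Lemma direction a c y : gp 1%g a^-1%g a <= c ->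
  gp 1%g a^-1%g y <= c + D \/ gp 1%g a y <= c + D.
Proof.
move=> h; have := gp_4pt d_hyp 1%g a^-1%g y a; rewrite (gpC d_hyp _ y).
by move=> [] ?; [left|right]; lra.
Qed.

(* If the axes of a and of v b v^-1 fellow travel, then the elements
   (a^j v)^-1 v b^j, j <= N, move two points of the axis of b by a bounded
   amount, so two of them coincide. *)
Lemma overlap_commute N a b v P Q c i k : 0 <= c ->
  card_le (coarse_stab (7 * c + 4 * D) 1%g b) N ->
  (forall l, d 1%g (b ^+ l)%g = d 1%g (a ^+ l)%g) ->
  (forall j, (j <= k + N)%N -> gp (a ^+ j)%g P Q <= c) ->
  (forall j l, (j + l <= k + N)%N ->
     d 1%g (a ^+ l)%g - c <= d P (a ^+ (j + l))%g - d P (a ^+ j)%g <= d 1%g (a ^+ l)%g) ->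
  (forall j, (i <= j <= i + N + 1)%N -> gp (v * b ^+ j)%g P Q <= c) ->
  (forall j l, (i <= j)%N -> (j + l <= i + N + 1)%N ->
     - c <= d P (v * b ^+ (j + l))%g - d P (v * b ^+ j)%g - d 1%g (a ^+ l)%g <= c) ->
  (forall j, (i <= j <= i + 1)%N ->
     d P 1%g <= d P (v * b ^+ j)%g <= d P (a ^+ k)%g) ->
  exists m, [/\ (0 < m)%N, (m <= N)%N & (a ^+ m * v = v * b ^+ m)%g].
Proof.
move=> c_ge0 bN lenb agp apos bgp bpos ab.
(* With z = v b^j, which is near the axis of a, both a^l z and v b^(j+l) are z advanced by l steps
   along [P, Q]; their distances to P agree up to 3 c + D. *)
have move_le j l : (i <= j <= i + 1)%N -> (l <= N)%N ->
    d (a ^+ l * (v * b ^+ j))%g (v * b ^+ (j + l))%g <= 7 * c + 4 * D.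
  move=> ij lN.
  have n1 : (i <= j <= i + N + 1)%N by lia.
  have n2 : (l <= k + N)%N by lia.
  have n3 : (k + l <= k + N)%N by lia.
  have n4 : (l + k <= k + N)%N by lia.
  have /andP[n5 _] := ij.
  have n6 : (j + l <= i + N + 1)%N by clear -ij lN; lia.
  have n7 : (i <= j + l <= i + N + 1)%N by rewrite n6 andbT (leq_trans n5) ?leq_addr.
  set z := (v * b ^+ j)%g.
  have [z0 zk] := andP (ab j ij).
  have zT : gp z P Q <= c by apply: bgp.
  have T0 := agp 0%N (leq0n _); have Tk := agp k (leq_addr _ _).
  have Tl := agp l n2; have Tkl := agp (k + l)%N n3.
  rewrite expg0 in T0.
  have n0 : d 1%g z <= d P z - d P 1%g + c + D.
    by apply: (gp_near d_hyp T0 zT) => //; lra.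
  have nk : d (a ^+ k)%g z <= d P (a ^+ k)%g - d P z + c + D.
    by apply: (gp_near d_hyp Tk zT) => //; lra.
  have e0 : d (a ^+ l)%g (a ^+ l * z)%g = d 1%g z by rewrite distM.
  have ek : d (a ^+ (k + l))%g (a ^+ l * z)%g = d (a ^+ k)%g z.
    by rewrite addnC expgnDr dL.
  have elk : d (a ^+ l)%g (a ^+ (k + l))%g = d 1%g (a ^+ k)%g by rewrite addnC pow_dist.
  have t1 := d_tri P (a ^+ l)%g (a ^+ l * z)%g.
  have t2 := d_tri P (a ^+ l * z)%g (a ^+ (k + l))%g.
  have t3 := d_tri Q (a ^+ (k + l))%g (a ^+ l * z)%g.
  have p1 := apos 0%N l n2; have p2 := apos 0%N k (leq_addr _ _).
  have p3 := apos k l n3; have p4 := apos l k n4.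
  rewrite !add0n expg0 in p1 p2; rewrite addnC in p4.
  have p5 := bpos j l n5 n6.
  rewrite -/z in p5.
  have az : gp (a ^+ l * z)%g P Q <= 4 * c + 2 * D.
    move: Tkl; rewrite /dgp (dC (a ^+ l * z)%g (a ^+ (k + l))%g) in t2 *; lra.
  have vz : gp (v * b ^+ (j + l))%g P Q <= 4 * c + 2 * D.
    have := bgp (j + l)%N n7; lraD.
  have -> : 7 * c + 4 * D = (3 * c + D) + (4 * c + 2 * D) + D by lra.
  rewrite (dC (a ^+ l * z)%g (a ^+ (k + l))%g) in t2.
  by apply: (gp_near d_hyp az vz); lra.
(* Conjugation by b^i turns [move_le] at j = i and j = i + 1 into bounds at 1 and b. These are N + 1
   elements of a set of size at most N. *)
pose K l := (b ^- i * ((a ^+ l * v)^-1 * (v * b ^+ l)) * b ^+ i)%g.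
have KS l : (l <= N)%N -> coarse_stab (7 * c + 4 * D) 1%g b (K l).
  move=> lN.
  have E j : (j <= 1)%N -> d (b ^+ j)%g (K l * b ^+ j)%g <= 7 * c + 4 * D.
    move=> j1; have n1 : (i <= i + j <= i + 1)%N by lia.
    apply: le_trans (move_le (i + j)%N l n1 lN).
    rewrite -[X in X <= _](dL (a ^+ l * v * b ^+ i)%g) le_eqVlt; apply/orP; left; apply/eqP.
    congr d; first by rewrite expgnDr !mulgA.
    have -> : (i + j + l = l + (i + j))%N by lia.
    by rewrite /K !mulgA mulgK mulgV mul1g !expgnDr !mulgA.
  by split; [have := E 0%N isT | have := E 1%N isT]; rewrite ?expg0 ?expg1.
have [j [l [jl lN]]] := card_le_pigeonhole bN KS.
rewrite /K => /mulIg /mulgI e.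
have lE : (l = (l - j) + j)%N by rewrite subnK // ltnW.
exists (l - j)%N; split; [by rewrite subn_gt0|exact: leq_trans (leq_subr _ _) lN|].
have al : (a ^+ l * v = a ^+ (l - j) * (a ^+ j * v))%g.
  by rewrite {1}lE expgnDr !mulgA.
apply: (@mulIg _ (b ^+ j)%g); rewrite -[RHS]mulgA -expgnDr -lE.
by rewrite -[RHS](mulVKg (a ^+ l * v)%g) -e al -[RHS]mulgA mulVKg mulgA.
Qed.

(* The powers of a form a quasi-geodesic, with step at least L, and a satisfies
   a WPD condition at the single scale e. *)
Definition good c L e N a : Prop :=
  [/\ gp 1%g a^-1%g a <= c, L <= d 1%g a & card_le (coarse_stab e 1%g a) N].

Lemma good_inv c L e N a : good c L e N a -> good c L e N a^-1%g.
Proof.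
move=> [h1 h2 h3]; split.
- by rewrite invgK (gpC d_hyp).
- by rewrite len_inv.
apply: coarse_stab_sym; have := coarse_stab_translate (g := a^-1%g) h3.
by rewrite mulg1 mulVg.
Qed.

(* 440 D is 7 * (62 D) + 4 D, from [overlap_commute], rounded up. *)
Local Notation good0 := (good (18 * D) (100 * D) (440 * D)).

(** * Powers of good elements *)

Section Good.
Variables (N : nat) (a : G).
Hypothesis a_good : good0 N a.

Lemma good_large : 100 * D <= d 1%g a. Proof. by case: a_good. Qed.

Lemma good_gp i j k : (i <= j)%N -> (j <= k)%N ->
  gp (a ^+ j)%g (a ^+ i)%g (a ^+ k)%g <= 20 * D.
Proof.
have [h1 h2 _] := a_good; move=> ij jk.
have -> : 20 * D = 18 * D + 2 * D by lra.
by apply: (pow_gp h1) ij jk; lraD.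
Qed.

Lemma good_lenD i j : d 1%g (a ^+ i)%g + d 1%g (a ^+ j)%g - 20 * D
  <= d 1%g (a ^+ (i + j))%g.
Proof.
have [h1 h2 _] := a_good.
have -> : 20 * D = 18 * D + 2 * D by lra.
by apply: (pow_lenD h1); lraD.
Qed.

Lemma good_len_lower i : d 1%g a / 2 * i%:R <= d 1%g (a ^+ i)%g.
Proof.
have [h1 h2 _] := a_good.
apply: le_trans (pow_len_lower h1 _ i); last by lraD.
by apply: ler_wpM2r => //; lraD.
Qed.

Lemma len_powD_le i j : d 1%g (a ^+ (i + j))%g <= d 1%g (a ^+ i)%g + d 1%g (a ^+ j)%g.
Proof. by rewrite expgnDr; apply: lenM _ _. Qed.

End Good.

(* Otherwise the axes of a and of s b s^-1 overlap along more than 66 + N steps. *)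
Lemma turn_bound N a b s k : good0 N a -> good0 N b ->
  (forall l, d 1%g (b ^+ l)%g = d 1%g (a ^+ l)%g) -> d 1%g s <= 10 * d 1%g a ->
  (forall m, (0 < m)%N -> (a ^+ m * s != s * b ^+ m)%g) -> (66 + N <= k)%N ->
  gp 1%g (a ^+ k)%g (s * b ^+ k)%g <= 2 * (66 + N)%:R * d 1%g a.
Proof.
move=> ga gb lenb len_s ab Nk.
case: leP => // big; exfalso.
suff [m [m0 _ e]] : exists m, [/\ (0 < m)%N, (m <= N)%N & (a ^+ m * s = s * b ^+ m)%g].
  by have := ab m m0; rewrite e eqxx.
have l0 := good_large ga.
set q := (s * b ^+ k)%g in big *.
set l := d 1%g a in l0 len_s big *.
have aT j : (j <= 66 + N)%N -> gp (a ^+ j)%g 1%g q <= 21 * D.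
  move=> jN.
  have fj : d 1%g (a ^+ j)%g <= l * (66 + N)%:R.
    apply: le_trans (pow_len_upper a j) _.
    by rewrite ler_wpM2l ?d_ge0 // ler_nat.
  have jk : (j <= k)%N by apply: leq_trans Nk.
  have g1 := good_gp ga (leq0n j) jk.
  rewrite expg0 in g1.
  have := gp_4pt d_hyp 1%g (a ^+ j)%g (a ^+ k)%g q.
  have := gp_flip d_hyp 1%g (a ^+ j)%g q.
  have := gp_flip d_hyp (a ^+ j)%g 1%g (a ^+ k)%g.
  by rewrite (dC (a ^+ j)%g); move=> ? ? [] ?; lraD.
have zlen j : d 1%g (b ^+ j)%g - d 1%g s <= d 1%g (s * b ^+ j)%g
     <= d 1%g s + d 1%g (b ^+ j)%g.
  have := d_tri s 1%g (s * b ^+ j)%g; have := d_tri 1%g s (s * b ^+ j)%g.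
  by rewrite distM (dC s); lra.
(* From j = 22 on, b^j has length at least 11 l, more than the length of s, at most 10 l; so s b^j
   is past any backtracking near s. *)
have bT j : (22 <= j)%N -> (j <= k)%N -> gp (s * b ^+ j)%g 1%g q <= 21 * D.
  move=> j22 jk.
  have g1 : gp (s * b ^+ j)%g s q <= 20 * D.
    rewrite -{2}(mulg1 s) gpL -(expg0 b); exact: (good_gp gb).
  have fj : l * 11 <= d 1%g (b ^+ j)%g.
    rewrite lenb; apply: le_trans (good_len_lower ga j).
    rewrite -/l; have -> : l * 11 = l / 2 * 22%:R by lra.
    by rewrite ler_wpM2l ?ler_nat //; lraD.
  have := gp_4pt d_hyp (s * b ^+ j)%g s 1%g q.
  have := zlen j; rewrite {1}/dgp distM (dC s 1%g) (dC 1%g (s * b ^+ j)%g).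
  move=> ? [] ?; lraD.
have bpos i j : (22 <= i)%N -> (i + j <= k)%N ->
    - (62 * D) <= d 1%g (s * b ^+ (i + j))%g - d 1%g (s * b ^+ i)%g - d 1%g (a ^+ j)%g
      <= 62 * D.
  move=> i22 ijk; rewrite -lenb.
  have h1 := bT i i22 (leq_trans (leq_addr _ _) ijk).
  have h2 : gp (s * b ^+ (i + j))%g (s * b ^+ i)%g q <= 20 * D.
    by rewrite gpL; apply: (good_gp gb) => //; apply: leq_addr.
  have e : d (s * b ^+ i)%g (s * b ^+ (i + j))%g = d 1%g (b ^+ j)%g.
    by rewrite dL pow_dist.
  have t1 := d_tri 1%g (s * b ^+ i)%g (s * b ^+ (i + j))%g.
  have t2 := d_tri 1%g (s * b ^+ (i + j))%g q.
  rewrite (dC (s * b ^+ (i + j))%g q) in t2.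
  move: h1 h2; rewrite /dgp => h1 h2.
  rewrite (dC q (s * b ^+ i)%g) in h1 h2.
  by lraD.
have [_ _ bN] := gb.
(* The exponent 66 is chosen so that a^66, of length at least 33 l, reaches beyond s b^23, of length
   at most 10 l + 23 l. *)
apply: (@overlap_commute N a b s 1%g q (62 * D) 22 66) => //.
- by lraD.
- by apply: coarse_stab_le bN; lraD.
- by move=> j jN; have := aT j jN; lraD.
- move=> i j ij; have := len_powD_le a i j; have := good_lenD ga i j.
  by lraD.
- move=> j j2; have j22 : (22 <= j)%N by case/andP: j2.
  have jk : (j <= k)%N by lia.
  by have := bT j j22 jk; lraD.
- by move=> i j i22 ij; apply: bpos => //; lia.
- move=> j j22; rewrite dxx d_ge0 /=.
  have := zlen j; have := good_len_lower ga 66.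
  have : d 1%g (b ^+ j)%g <= l * 23%:R.
    rewrite lenb; apply: le_trans (pow_len_upper a j) _.
    by rewrite ler_wpM2l ?d_ge0 // ler_nat; lia.
  by rewrite -/l; lraD.
Qed.

(** * Separating words *)

Definition sep_exp N := (3 * N + 147)%N.

Definition separator N a b s := (a ^+ sep_exp N * s * b ^+ sep_exp N)%g.

(** Seen from a^k with k = [sep_exp N], the word turns from a^-k to s b^k, and [turn_bound] for a^-1
    and b limits the overlap to depth (66 + N) l. As k = (N + 14) + (2 (66 + N) + 1) and each step
    is worth at least l / 2, the points a^i lie before that overlap. *)
Lemma separator_gp N a b s i : good0 N a -> good0 N b ->
  (forall l, d 1%g (b ^+ l)%g = d 1%g (a ^+ l)%g) -> d 1%g s <= 10 * d 1%g a ->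
  (forall m, (0 < m)%N -> (a^-1 ^+ m * s != s * b ^+ m)%g) -> (i <= N + 14)%N ->
  gp (a ^+ i)%g 1%g (separator N a b s) <= 21 * D.
Proof.
move=> ga gb lenb len_s ab iN.
have ik : (i <= sep_exp N)%N by rewrite /sep_exp; lia.
have turn : gp (a ^+ sep_exp N)%g 1%g (separator N a b s) <= 2 * (66 + N)%:R * d 1%g a.
  have lenb' j : d 1%g (b ^+ j)%g = d 1%g (a^-1 ^+ j)%g.
    by rewrite len_expV.
  have len_s' : d 1%g s <= 10 * d 1%g a^-1%g by rewrite len_inv.
  have nk : (66 + N <= sep_exp N)%N by rewrite /sep_exp; lia.
  have := turn_bound (good_inv ga) gb lenb' len_s' ab nk.
  rewrite -(gpL (a ^+ sep_exp N)%g) expVgn mulgV mulg1 mulgA.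
  by rewrite len_inv.
have l0 := good_large ga.
have far : d 1%g a / 2 * (2 * (66 + N) + 1)%:R <= d (a ^+ i)%g (a ^+ sep_exp N)%g.
  have -> : sep_exp N = (i + (sep_exp N - i))%N by rewrite subnKC.
  rewrite pow_dist; apply: le_trans (good_len_lower ga _).
  rewrite ler_wpM2l ?ler_nat //; last by rewrite /sep_exp; lia.
  by rewrite divr_ge0.
set u := separator N a b s in turn *; set z := (a ^+ sep_exp N)%g in turn far *.
have := good_gp ga (leq0n i) ik; rewrite expg0 -/z => g1.
have : d 1%g a / 2 * (2 * (66 + N) + 1)%:R =
    (2 * (66 + N)%:R * d 1%g a) / 2 + d 1%g a / 2.
  by rewrite natrD natrM; lra.
set W := _ / 2 * _%:R in far *; set O := 2 * _ * d 1%g a in turn * => WO.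
have := gp_4pt d_hyp z 1%g (a ^+ i)%g u.
have := gp_4pt d_hyp (a ^+ i)%g 1%g u z.
have := gp_flip d_hyp (a ^+ i)%g z 1%g.
have := gp_flip d_hyp z (a ^+ i)%g u.
rewrite (dC z) (gpC d_hyp z (a ^+ i)%g 1%g) (gpC d_hyp (a ^+ i)%g z 1%g).
rewrite (gpC d_hyp (a ^+ i)%g z u).
by clearbody W O; move=> ? ? [] ? [] ?; lraD.
Qed.

Section Decompositions.
Variables (N : nat) (a u : G).
Hypothesis a_good : good0 N a.
Hypothesis u_gp : forall i, (i <= N + 14)%N -> gp (a ^+ i)%g 1%g u <= 21 * D.

Let len_low := good_len_lower a_good.

Lemma separator_len : 100 * D <= d 1%g u.
Proof.
have l0 := good_large a_good.
have := u_gp (i := 14) (leq_addl _ _); have := len_low 14.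
have := d_ge0 u (a ^+ 14)%g; rewrite /dgp; lraD.
Qed.

Lemma separator_direction y : gp 1%g y a <= 19 * D -> gp 1%g y u <= 20 * D.
Proof.
move=> h; have l0 := good_large a_good.
have := u_gp (i := 1) (leq_trans (isT : (1 <= 14)%N) (leq_addl N 14)); rewrite expg1.
have := gp_4pt d_hyp 1%g y u a.
by have := gp_flip d_hyp a 1%g u; rewrite (gpC d_hyp 1%g a) (dC a); move=> ? [] ?; lraD.
Qed.

Lemma power_direction y i : gp 1%g y a <= 19 * D -> gp 1%g y (a ^+ i)%g <= 20 * D.
Proof.
case: i => [|i] h.
  by rewrite expg0 /dgp dxx dC; lraD.
have l0 := good_large a_good.
have := good_gp a_good (i := 0) (j := 1) (k := i.+1) isT isT.
rewrite expg0 expg1.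
have := gp_4pt d_hyp 1%g y (a ^+ i.+1)%g a.
have := gp_flip d_hyp a 1%g (a ^+ i.+1)%g.
by rewrite (gpC d_hyp 1%g a) (dC a); move=> ? [] ?; lraD.
Qed.

Lemma separator_concat P Q : gp 1%g P u <= 20 * D -> gp 1%g u^-1%g (u^-1 * Q)%g <= 20 * D ->
  gp 1%g P Q <= 21 * D /\ gp u P Q <= 21 * D.
Proof.
move=> h; rewrite -(gpL u) mulg1 mulgV mulVKg => h'.
have lu := separator_len.
have := gp_4pt d_hyp 1%g P Q u; have := gp_4pt d_hyp u 1%g P Q.
have := gp_flip d_hyp 1%g u P; have := gp_flip d_hyp 1%g u Q.
rewrite (gpC d_hyp 1%g Q u) (gpC d_hyp 1%g P u) in h *.
by move=> ? ? [] ? [] ?; split; lraD.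
Qed.

(** By [gp_nest], 62 D = 21 D + 20 D + 21 D collects the backtracking at a^i, at 1 and at u. *)
Lemma decomposition_power w w' i : gp 1%g w^-1%g a <= 19 * D ->
  gp 1%g u^-1%g w' <= 20 * D -> (i <= N + 14)%N ->
  gp (a ^+ i)%g w^-1%g (u * w')%g <= 62 * D.
Proof.
move=> h h' iN.
have h1 := separator_direction h.
have [|h2 h3] := separator_concat (P := w^-1%g) (Q := (u * w')%g) h1.
  by rewrite mulKg.
have := gp_nest d_hyp w^-1%g (u * w')%g 1%g u (a ^+ i)%g.
by have := u_gp iN; lraD.
Qed.

(** Translated by w1^-1, both decompositions run along the same segment [P, Q], which follows the
    axis of a and that of v a v^-1; since w1 and w2 have about the same length, the two stretches
    overlap. *)
Lemma decomposition_shift w1 w2 w1' w2' :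
  (w1 * u * w1' = w2 * u * w2')%g ->
  gp 1%g w1^-1%g a <= 19 * D -> gp 1%g w2^-1%g a <= 19 * D ->
  gp 1%g u^-1%g w1' <= 20 * D -> gp 1%g u^-1%g w2' <= 20 * D ->
  - d 1%g a <= d 1%g w1 - d 1%g w2 <= d 1%g a ->
  exists m, [/\ (0 < m)%N, (m <= N)%N
    & (a ^+ m * (w1^-1 * w2) = (w1^-1 * w2) * a ^+ m)%g].
Proof.
move=> e h1 h2 h1' h2' len12; have l0 := good_large a_good.
set v := (w1^-1 * w2)%g; set P := w1^-1%g in h1 *; set Q := (u * w1')%g.
have Pv : P = (v * w2^-1)%g by rewrite /v mulgK.
have Qv : Q = (v * (u * w2'))%g.
  by rewrite /v /Q -!mulgA; apply: (mulgI w1); rewrite mulVKg !mulgA.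
have dist_a w i : gp 1%g w^-1%g a <= 19 * D ->
    d 1%g w + d 1%g (a ^+ i)%g - 20 * D <= d w^-1%g (a ^+ i)%g <=
    d 1%g w + d 1%g (a ^+ i)%g.
  move=> h; have := power_direction i h; rewrite /dgp.
  have := d_tri w^-1%g 1%g (a ^+ i)%g.
  by rewrite (dC w^-1%g 1%g) len_inv (dC (a ^+ i)%g 1%g); lraD.
have PaE i : d P (v * a ^+ i)%g = d w2^-1%g (a ^+ i)%g by rewrite Pv dL.
have [_ _ aN] := a_good.
(* The lengths of w1 and w2 differ by at most l. The length of a^4, at least 2 l, makes up for this
   on one side; a^14, of length at least 7 l, exceeds a^5, of length at most 5 l, by enough on the
   other. *)
apply: (@overlap_commute N a a v P Q (62 * D) 4 14) => //.
- by lraD.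
- by apply: coarse_stab_le aN; lraD.
- by move=> j jN; apply: decomposition_power => //; rewrite addnC.
- move=> i j ij; have := dist_a w1 i h1; have := dist_a w1 (i + j)%N h1.
  rewrite -/P; have := len_powD_le a i j.
  have := good_lenD a_good i j.
  have := d_ge0 1%g (a ^+ (i + j))%g.
  have := dist_tri d_hyp P (a ^+ i)%g (a ^+ (i + j))%g; rewrite pow_dist.
  by lraD.
- move=> j j4; rewrite Pv Qv gpL; apply: decomposition_power => //; lia.
- move=> i j i4 ij; rewrite !PaE.
  have := dist_a w2 i h2; have := dist_a w2 (i + j)%N h2.
  have := len_powD_le a i j.
  have := good_lenD a_good i j.
  by lraD.
- move=> j j4; rewrite PaE.
  have := dist_a w2 j h2; have := dist_a w1 14 h1; rewrite -/P.
  have := len_low 14; have := len_low j.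
  have := pow_len_upper a j.
  have : d 1%g a / 2 * 4%:R <= d 1%g a / 2 * j%:R.
    by rewrite ler_wpM2l ?ler_nat ?divr_ge0 //; case/andP: j4.
  have : d 1%g a * j%:R <= d 1%g a * 5%:R.
    by rewrite ler_wpM2l ?ler_nat //; case/andP: j4.
  by rewrite (dC P 1%g) len_inv; lraD.
Qed.

End Decompositions.

(** * Normalizers of axes *)

Definition intertwines a b f := (f * a = b * f)%g.

Lemma intertwinesX a b f i : intertwines a b f -> intertwines (a ^+ i)%g (b ^+ i)%g f.
Proof.
rewrite /intertwines => h; elim: i => [|i IH]; first by rewrite !expg0 mulg1 mul1g.
by rewrite expgSr mulgA IH -mulgA h mulgA -expgSr.
Qed.

Definition normalizes a f := intertwines a a f \/ intertwines a a^-1%g f.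

Section Axis.
Variables (b : G) (c : R).
Hypothesis b_gp : gp 1%g b^-1%g b <= c.
Hypothesis b_len : c + 3 * D <= d 1%g b.

Let c_ge0 : 0 <= c. Proof. by apply: le_trans b_gp; apply: gp_ge0 d_hyp _ _ _. Qed.
Let b_len' : c + 2 * D <= d 1%g b. Proof. by have := b_len; lraD. Qed.

Lemma pow_unbounded C : exists M0, forall M, (M0 <= M)%N -> C < d 1%g (b ^+ M)%g.
Proof.
exists (Num.bound (`|C| / D)) => M M0M.
apply: lt_le_trans (pow_len_lower b_gp b_len' M).
have : D * M%:R <= (d 1%g b - (c + 2 * D)) * M%:R.
  by apply: ler_wpM2r => //; have := b_len; have := c_ge0; lraD.
apply: lt_le_trans; apply: le_lt_trans (ler_norm C) _.
rewrite mulrC -ltr_pdivrMr //.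
apply: lt_le_trans (archi_boundP _) _; last by rewrite ler_nat.
by rewrite divr_ge0 // ltW.
Qed.

Let powV M : (b ^- M = b^-1 ^+ M)%g. Proof. by rewrite expVgn. Qed.

(** The point f is near the segment from f b^-M to f b^M, whose ends are within C of b^-M and b^M in
    one order or the other. For M large [gp_move] exchanges them, with an error independent of C. *)
Lemma axis_gp C : exists M0, forall M, (M0 <= M)%N -> forall f,
  d 1%g f <= C -> normalizes b f -> gp f (b ^- M)%g (b ^+ M)%g <= c + 4 * D.
Proof.
have [M0 HM] := pow_unbounded (2 * C + c + 4 * D); exists M0 => M M0M f fC nf.
have {HM M0M} lM := HM M M0M.
have -> : c + 4 * D = (c + 2 * D) + 2 * D by lra.
have lM' : d 1%g (b ^- M)%g = d 1%g (b ^+ M)%g by rewrite len_inv.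
have far1 : C + (c + 2 * D) + 2 * D < d f (b ^- M)%g.
  by have := d_tri 1%g f (b ^- M)%g; lra.
have far2 : C + (c + 2 * D) + 2 * D < d f (b ^+ M)%g.
  by have := d_tri 1%g f (b ^+ M)%g; lra.
have h1 := pow_gp1 b_gp b_len' M.
case: nf => /(intertwinesX M) nf.
  have nf' : (f * b ^- M = b ^- M * f)%g.
    apply: (mulgI (b ^+ M)%g); apply: (@mulIg _ (b ^+ M)%g).
    by rewrite mulVKg -!mulgA mulVg mulg1.
  apply: (gp_move d_hyp D_gt0 (P' := (f * b ^- M)%g) (Q' := (f * b ^+ M)%g) (C := C)) => //.
  - by rewrite -{1}(mulg1 f) gpL.
  - by rewrite nf' distM.
  - by rewrite nf distM.
have nf' : (f * b ^- M = b ^+ M * f)%g.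
  apply: (@mulIg _ (b ^+ M)%g); rewrite -mulgA mulVg mulg1 -mulgA nf expVgn.
  by rewrite mulVKg.
apply: (gp_move d_hyp D_gt0 (P' := (f * b ^+ M)%g) (Q' := (f * b ^- M)%g) (C := C)) => //.
- by rewrite -{1}(mulg1 f) gpL (gpC d_hyp).
- by rewrite nf powV distM.
- by rewrite nf' distM.
Qed.

Lemma len_pow_le v i j : (i <= j)%N -> d 1%g (v ^+ i)%g <= d 1%g v * j%:R.
Proof.
move=> ij; apply: le_trans (pow_len_upper v i) _.
by rewrite ler_wpM2l // ler_nat.
Qed.

(* A torsion element shifting the axis of b by t would shift it by about J t
   under its J-th power, which is trivial; the error at each step is at most D
   because the endpoint of the axis may be moved by a bounded amount. *)
Lemma torsion_len v J : intertwines b b v -> (0 < J)%N -> (v ^+ J = 1)%g ->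
  d 1%g v <= c + 6 * D.
Proof.
move=> vb J0 vJ; set C := d 1%g v * J%:R.
have [M1 HM1] := axis_gp C; have [M2 HM2] := pow_unbounded (3 * C + D).
set M := maxn M1 M2; have {HM1} axis := HM1 M (leq_maxl _ _).
have {HM2} lM := HM2 M (leq_maxr _ _).
set P := (b ^- M)%g in axis; set rho := d P.
have lP : d 1%g P = d 1%g (b ^+ M)%g by rewrite /P len_inv.
have vC : d 1%g v <= C by have := len_pow_le v J0; rewrite expg1.
have Pv j : (v ^- j * P = P * v ^- j)%g.
  have := commuteX2 M j (esym vb); rewrite /commute => e.
  by apply: invg_inj; rewrite !invgM !invgK e.
set t := rho v - rho 1%g.
have step j : (j < J)%N -> - D <= rho (v ^+ j.+1)%g - rho (v ^+ j)%g - t <= D.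
  move=> jJ; set P' := (v ^- j * P)%g.
  have e1 : rho (v ^+ j.+1)%g = d P' v.
    by rewrite /rho -(dL (v ^- j)%g) expgSr mulKg.
  have e2 : rho (v ^+ j)%g = d P' 1%g.
    by rewrite /rho -(dL (v ^- j)%g) mulVg.
  have PP : d P P' <= C.
    by rewrite /P' Pv distM len_inv; apply: len_pow_le; apply: ltnW.
  have far : C + d v 1%g + D < d P v + d P' 1%g.
    have := d_tri 1%g v P; have := d_ge0 P' 1%g.
    by rewrite (dC v 1%g) (dC v P); lraD.
  have far' : C + d 1%g v + D < d P 1%g + d P' v.
    by have := d_ge0 P' v; have := d_ge0 1%g v; rewrite (dC P 1%g); lraD.
  have := dist_shift d_hyp PP far; have := dist_shift d_hyp PP far'.
  by rewrite e1 e2 /t /rho; lra.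
have sum j : (j <= J)%N ->
    - (D * j%:R) <= rho (v ^+ j)%g - rho 1%g - t * j%:R <= D * j%:R.
  elim: j => [|j IH] jJ; first by rewrite expg0; lra.
  by have := IH (ltnW jJ); have := step j jJ; rewrite -natr1; lra.
have := sum J (leqnn J); rewrite vJ subrr sub0r => /andP[s1 s2].
have J0' : 0 < J%:R :> R by rewrite ltr0n.
have t1 : t <= D by rewrite -(ler_pM2r J0'); lra.
have t2 : - D <= t by rewrite -(ler_pM2r J0'); lra.
have n1 : gp 1%g P (b ^+ M)%g <= c + 4 * D.
  apply: axis; first by rewrite dxx mulr_ge0.
  by left; rewrite /intertwines mulg1 mul1g.
have nv : gp v P (b ^+ M)%g <= c + 4 * D by apply: axis => //; left.
have -> : c + 6 * D = D + (c + 4 * D) + D by lra.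
by apply: (gp_near d_hyp n1 nv); rewrite -/rho; rewrite /t in t1 t2; lra.
Qed.

End Axis.

Lemma axis_len b c : gp 1%g b^-1%g b <= c -> 2 * c + 8 * D <= d 1%g b ->
  c + 3 * D <= d 1%g b.
Proof. by have := gp_ge0 d_hyp 1%g b^-1%g b; lraD. Qed.

Section Axis.
Variables (b : G) (c : R).
Hypothesis b_gp : gp 1%g b^-1%g b <= c.
Hypothesis b_len : 2 * c + 8 * D <= d 1%g b.

Let c_ge0 : 0 <= c. Proof. by apply: le_trans b_gp; apply: gp_ge0 d_hyp _ _ _. Qed.

(** Elements are sorted by position along the axis, in windows of width D, and by whether they
    commute with b. If f and g share a class, then d f g is small and equals d (f b) (g b), so f^-1
    g lies in the coarse stabilizer. *)
Lemma normalizer_finite N C :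
  card_le (coarse_stab (c + 6 * D) 1%g b) N ->
  exists K, card_le (fun f => normalizes b f /\ d 1%g f <= C) K.
Proof.
move=> bN; have [M HM] := axis_gp b_gp (axis_len b_gp b_len) C.
have {HM} axis := HM M (leqnn M); set P := (b ^- M)%g in axis.
pose idx f := (2 * Num.truncn (d P f / D) + `[< intertwines b b f >])%N.
exists ((2 * (Num.truncn ((d P 1%g + C) / D)).+1) * N)%N.
apply: (card_le_fibers (idx := idx)) => [f [nf fC]|i].
  rewrite /idx; have : (Num.truncn (d P f / D) <= Num.truncn ((d P 1%g + C) / D))%N.
    apply: le_truncn; apply: ler_wpM2r; first by rewrite invr_ge0 ltW.
    by have := d_tri P 1%g f; lra.
  by set u := Num.truncn _; set t := Num.truncn _ => ut; case: `[< _ >] => /=; lia.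
apply: card_le_diff bN => f g [[nf fC] fi] [[ng gC] gi].
have [ei eb] : Num.truncn (d P f / D) = Num.truncn (d P g / D) /\
    (intertwines b b f <-> intertwines b b g).
  move: fi gi; rewrite /idx.
  by do 2 case: asboolP => ?; move=> ? ?; split; try lia; tauto.
have Df : D * (d P f / D) = d P f by rewrite mulrC divfK // gt_eqF.
have Dg : D * (d P g / D) = d P g by rewrite mulrC divfK // gt_eqF.
have tr x : 0 <= x / D -> D * (Num.truncn (x / D))%:R <= D * (x / D) /\
    D * (x / D) < D * (Num.truncn (x / D)).+1%:R.
  move=> x0; have /andP[] := truncn_itv x0; rewrite -(ler_pM2l D_gt0) => h1.
  by rewrite -(ltr_pM2l D_gt0).
have [f1 f2] := tr (d P f) (divr_ge0 (d_ge0 _ _) (ltW D_gt0)).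
have [g1 g2] := tr (d P g) (divr_ge0 (d_ge0 _ _) (ltW D_gt0)).
rewrite Df ei -natr1 in f1 f2; rewrite Dg -natr1 in g1 g2.
have fg : d f g <= c + 6 * D.
  have -> : c + 6 * D = D + (c + 4 * D) + D by lra.
  have hf := axis f fC nf; have hg := axis g gC ng.
  by clear fi gi ei eb idx; apply: (gp_near d_hyp hf hg); lra.
have fgb : d (f * b)%g (g * b)%g = d f g.
  case: nf; case: ng; rewrite /intertwines.
  - by move=> -> ->; rewrite dL.
  - by move=> _ fb; move: fb (eb.1 fb) => -> ->; rewrite dL.
  - by move=> gb _; rewrite gb (eb.2 gb) dL.
  - by move=> -> ->; rewrite dL.
split; first by rewrite mulg1 -(dL f) mulg1 mulVKg.
by rewrite -(dL f) !mulgA mulgV mul1g fgb.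
Qed.

(** Near the axis, distances are differences of positions up to bounded errors. The size of f
    excludes a position before b, and past b the length of b outweighs the errors. *)
Lemma axis_closer M f : (0 < M)%N -> gp f (b ^- M)%g (b ^+ M)%g <= c + 4 * D ->
  d (b ^- M)%g 1%g - (c + 2 * D) <= d (b ^- M)%g f ->
  d 1%g b + 2 * c + 10 * D < d 1%g f -> d b f <= d 1%g f - D.
Proof.
move=> M0; set P := (b ^- M)%g; set Q := (b ^+ M)%g => Tf Pf fbig.
have b_len' : c + 2 * D <= d 1%g b by have := b_len; have := c_ge0; lraD.
have b_pow := pow_gp b_gp b_len'.
have QE : (Q * P = 1)%g by rewrite mulgV.
have T1 : gp 1%g P Q <= c + 2 * D by apply: pow_gp1.
have Tb : gp b P Q <= c + 2 * D.
  rewrite -(gpL Q) QE -!expgnDr -(expg0 b) -{1}(expg1 b) -expgnDr.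
  by apply: b_pow; [|rewrite leq_add2l].
have T1b : gp 1%g P b <= c + 2 * D.
  by rewrite -(gpL Q) QE mulg1 -expgSr -(expg0 b); apply: b_pow.
have near1 r : d P 1%g - d P f <= r -> d P f - d P 1%g <= r ->
    d 1%g f <= r + (c + 4 * D) + D.
  by apply: (gp_near d_hyp _ Tf); lraD.
have nearb r : d P b - d P f <= r -> d P f - d P b <= r ->
    d b f <= r + (c + 4 * D) + D.
  by apply: (gp_near d_hyp _ Tf); lraD.
have t1 := d_tri P 1%g f; have t2 := d_tri P 1%g b.
have {}T1b : d P 1%g + d 1%g b - (c + 2 * D) <= d P b.
  by move: T1b; rewrite /dgp (dC b 1%g); lra.
clear T1 Tb Tf QE.
have bl := b_len; have c0 := c_ge0; have D0 := D_gt0.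
case: (leP (d P f - d P 1%g) (c + 2 * D)) => h1.
  by have := near1 (c + 2 * D); lra.
have n1 := near1 (d P f - d P 1%g) ltac:(lra) (lexx _).
case: (leP (d P b) (d P f)) => h2; last by lra.
by have := nearb (d P f - d P b) ltac:(lra) (lexx _); lra.
Qed.
End Axis.

Lemma intertwinesV a b f : intertwines a b f -> intertwines a^-1%g b^-1%g f.
Proof.
rewrite /intertwines => h.
by apply: (mulgI b); apply: (@mulIg _ a); rewrite mulVKg -!mulgA mulVg mulg1.
Qed.

Lemma normalizesV b f : normalizes b f -> normalizes b^-1%g f.
Proof. by case=> /intertwinesV h; [left|right]. Qed.

(** Division with remainder along the axis: while f is long, [axis_closer] gives a factor b or b^-1
    that shortens it by D, and this factor can be moved to the right because f normalizes b. *)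
Lemma axis_reduce b c f : gp 1%g b^-1%g b <= c -> 2 * c + 8 * D <= d 1%g b ->
  normalizes b f ->
  exists2 z, cyclic_subgroup b z & d 1%g (f * z)%g <= d 1%g b + 2 * c + 10 * D.
Proof.
move=> b_gp b_len.
have [m] : exists m, d 1%g f <= D * m%:R.
  exists (Num.bound (d 1%g f / D)).
  rewrite -ler_pdivrMl // mulrC; apply: ltW; apply: archi_boundP.
  by rewrite divr_ge0 // ltW.
elim: m f => [|m IH] f fm nf.
  exists 1%g; first by exists 0%N; left; rewrite expg0.
  rewrite mulg1; apply: le_trans fm _; rewrite mulr0.
  have := gp_ge0 d_hyp 1%g b^-1%g b; lraD.
case: (leP (d 1%g f) (d 1%g b + 2 * c + 10 * D)) => [h|big].
  by exists 1%g; [exists 0%N; left; rewrite expg0|rewrite mulg1].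
have step z : (cyclic_subgroup b z)%classic -> (z = b \/ z = b^-1)%g ->
    d 1%g (f * z)%g <= d 1%g f - D ->
    exists2 z, cyclic_subgroup b z & d 1%g (f * z)%g <= d 1%g b + 2 * c + 10 * D.
  move=> cz zb h.
  have nfz : normalizes b (f * z)%g.
    have bz : (z * b = b * z)%g.
      by case: zb => ->//; rewrite mulVg mulgV.
    by case: nf => nf; [left|right]; rewrite /intertwines -mulgA bz !mulgA nf.
  have [|z' cz' hz'] := IH (f * z)%g _ nfz.
    by move: fm; rewrite -natr1; lra.
  by exists (z * z')%g; [apply: cyclic_subgroupM|rewrite mulgA].
have [M1 HM1] := axis_gp b_gp (axis_len b_gp b_len) (d 1%g f).
have b_len' : c + 2 * D <= d 1%g b.
  by have := gp_ge0 d_hyp 1%g b^-1%g b; lraD.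
set M := maxn 1 M1; have Tf := HM1 M (leq_maxr _ _) f (lexx _) nf.
have M0 : (0 < M)%N by apply: leq_maxl.
have [z zb zf] : exists2 z, (z = b \/ z = b^-1)%g & d z f <= d 1%g f - D.
  (* Either f is not behind 1 on the axis, or the axis is read backwards, with b^-1 for b. *)
  case: (leP (d (b ^- M)%g 1%g - (c + 2 * D)) (d (b ^- M)%g f)) => h.
    exists b; first by left.
    exact: (axis_closer b_gp b_len M0 Tf).
  exists (b^-1)%g; first by right.
  apply: (@axis_closer b^-1%g c _ _ M f) => //.
  - by rewrite invgK (gpC d_hyp).
  - by rewrite len_inv.
  - by rewrite expVgn invgK (gpC d_hyp).
  - rewrite expVgn invgK.
    have := pow_gp1 b_gp b_len' M.
    rewrite /dgp; have := d_tri (b ^- M)%g f (b ^+ M)%g.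
    by have := le_trans (gp_ge0 d_hyp 1%g b^-1%g b) b_gp; rewrite (dC f (b ^+ M)%g); lraD.
  - by rewrite len_inv.
have cyc : cyclic_subgroup b b /\ cyclic_subgroup b b^-1%g.
  by split; exists 1%N; [left|right].
have zE x : d x f = d 1%g (x^-1 * f)%g by rewrite -(dL x^-1%g) mulVg.
rewrite zE in zf.
case: zb zf => ->; case: nf => nf h.
- apply: (step b^-1%g) => //; [exact: cyc.2|by right|].
  suff -> : (f * b^-1 = b^-1 * f)%g by [].
  by apply: (mulgI b); apply: (@mulIg _ b); rewrite mulVKg -!mulgA mulVg mulg1.
- apply: (step b) => //; [exact: cyc.1|by left|].
  by rewrite nf.
- apply: (step b) => //; [exact: cyc.1|by left|].
  by rewrite nf; move: h; rewrite invgK.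
- apply: (step b^-1%g) => //; [exact: cyc.2|by right|].
  suff -> : (f * b^-1 = b * f)%g by move: h; rewrite invgK.
  by apply: (@mulIg _ b); rewrite -mulgA mulVg mulg1 -mulgA nf mulVKg.
Qed.

(** * Commensurating a good element *)

Definition commensurates a f := exists2 m, (0 < m)%N & normalizes (a ^+ m)%g f.

Section Good.
Variables (N : nat) (a : G).
Hypothesis a_good : good0 N a.

Let l0 := good_large a_good.

Lemma good_pow m : (0 < m)%N ->
  gp 1%g (a ^+ m)^-1%g (a ^+ m)%g <= 20 * D /\ 2 * (20 * D) + 8 * D <= d 1%g (a ^+ m)%g.
Proof.
have [h1 _ _] := a_good.
have h2 : 18 * D + 2 * D <= d 1%g a by have := l0; lraD.
move=> m0; split.
  by have := pow_gp1 h1 h2 m; lra.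
have := pow_len_lower h1 h2 m.
have : (d 1%g a - (18 * D + 2 * D)) * 1 <= (d 1%g a - (18 * D + 2 * D)) * m%:R.
  by apply: ler_wpM2l; [lra|rewrite ler1n].
by have := l0; lraD.
Qed.

Lemma good_pow_stab m v : (0 < m)%N ->
  coarse_stab (26 * D) 1%g (a ^+ m)%g v -> coarse_stab (440 * D) 1%g a v.
Proof.
move=> m0 h.
have := good_gp a_good (i := 0) (j := 1) (k := m) isT m0.
rewrite expg0 expg1 => /(coarse_stab_between) /(_ h) [h1 h2].
by split; lraD.
Qed.

Lemma good_pow_card m : (0 < m)%N ->
  card_le (coarse_stab (20 * D + 6 * D) 1%g (a ^+ m)%g) N.
Proof.
move=> m0; have [_ _] := a_good; apply: card_le_sub => v hv.
apply: (good_pow_stab m0); have <- : 20 * D + 6 * D = 26 * D by lra.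
exact: hv.
Qed.

Lemma cyclic_subgroup_pow m z : cyclic_subgroup (a ^+ m)%g z -> cyclic_subgroup a z.
Proof. by move=> [n [->|->]]; exists (m * n)%N; [left|right]; rewrite expgnA. Qed.

(** Reduced by powers of a^m, all v^j have bounded length and commute with a^m; there are finitely
    many such elements, so two reductions coincide. *)
Lemma power_of_commuting m v : (0 < m)%N -> intertwines (a ^+ m)%g (a ^+ m)%g v ->
  exists2 J, (0 < J)%N & cyclic_subgroup a (v ^+ J)%g.
Proof.
move=> m0 mv; have [b_gp b_len] := good_pow m0; set b := (a ^+ m)%g in mv b_gp b_len *.
have [K HK] := normalizer_finite b_gp b_len
  (d 1%g b + 2 * (20 * D) + 10 * D) (good_pow_card m0).
have vj j : intertwines b b (v ^+ j)%g.
  by apply: commute_sym; apply: commuteX; apply: esym.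
have /choice[z Hz] : forall j, exists z, cyclic_subgroup b z /\
    d 1%g (v ^+ j * z)%g <= d 1%g b + 2 * (20 * D) + 10 * D.
  move=> j; have [z hz1 hz2] := axis_reduce b_gp b_len (or_introl (vj j)).
  by exists z.
have bz j : (z j * b = b * z j)%g.
  case: (Hz j) => [[n [->|->]] _]; first by rewrite -expgS -expgSr.
  by apply: commute_sym; apply: commuteV; apply: commuteX.
have [|i [l [il _ e]]] := card_le_pigeonhole (f := fun j => (v ^+ j * z j)%g) HK.
  move=> j _; split; last exact: (Hz j).2.
  by left; rewrite /intertwines -mulgA bz !mulgA vj.
exists (l - i)%N; first by rewrite subn_gt0.
apply: (@cyclic_subgroup_pow m).
have -> : (v ^+ (l - i) = z i * (z l)^-1)%g.
  apply: (@mulIg _ (z l)); rewrite mulgVK; apply: (mulgI (v ^+ i)%g).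
  by rewrite e mulgA -expgnDr subnKC // ltnW.
by apply: cyclic_subgroupM; [exact: (Hz i).1|apply: cyclic_subgroupV; exact: (Hz l).1].
Qed.

(** Otherwise a^((q - p) M) would have length bounded in M. *)
Lemma pow_len_separated p q C :
  (forall M, d 1%g (a ^+ (q * M))%g <= d 1%g (a ^+ (p * M))%g + C) -> (q <= p)%N.
Proof.
move=> h; rewrite leqNgt; apply/negP => pq.
set M := Num.bound ((`|C| + 20 * D) / D).
have := h M; have := good_lenD a_good (p * M) ((q - p) * M).
rewrite -mulnDl subnKC; last exact: ltnW.
have := good_len_lower a_good ((q - p) * M).
have : d 1%g a / 2 * M%:R <= d 1%g a / 2 * ((q - p) * M)%:R.
  rewrite ler_wpM2l ?divr_ge0 // ler_nat leq_pmull // subn_gt0 //.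
have : D * M%:R <= d 1%g a / 2 * M%:R by rewrite ler_wpM2r //; have := l0; lraD.
have : (`|C| + 20 * D) < D * M%:R.
  rewrite (mulrC D M%:R) -ltr_pdivrMr //; apply: archi_boundP.
  by apply: divr_ge0; [have := normr_ge0 C; lraD|exact: ltW].
by have := ler_norm C; lra.
Qed.

(** Conjugation by u changes lengths by at most twice the length of u, while those of the M-th
    powers grow linearly in M. *)
Lemma conjugate_exponents u p q f : (f = a \/ f = a^-1)%g ->
  (u * a ^+ q = f ^+ p * u)%g -> p = q.
Proof.
move=> fa h.
have hM M : (u * a ^+ (q * M) = f ^+ (p * M) * u)%g.
  by rewrite !expgnA; apply: (@intertwinesX (a ^+ q)%g (f ^+ p)%g).
have le M : d 1%g (f ^+ (p * M))%g = d 1%g (a ^+ (p * M))%g.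
  by case: fa => -> //; rewrite len_expV.
have uV := len_inv u.
apply/eqP; rewrite eqn_leq; apply/andP; split.
  apply: (@pow_len_separated q p (2 * d 1%g u)) => M; rewrite -le.
  have -> : (f ^+ (p * M) = u * a ^+ (q * M) * u^-1)%g by rewrite hM mulgK.
  have := lenM (u * a ^+ (q * M))%g u^-1%g.
  by have := lenM u (a ^+ (q * M))%g; lra.
apply: (@pow_len_separated p q (2 * d 1%g u)) => M; rewrite -le.
have -> : (a ^+ (q * M) = u^-1 * (f ^+ (p * M) * u))%g by rewrite -hM mulKg.
have := lenM u^-1%g (f ^+ (p * M) * u)%g.
by have := lenM (f ^+ (p * M))%g u; lra.
Qed.

Lemma commuting_torsion_stab m v J : (0 < m)%N -> intertwines (a ^+ m)%g (a ^+ m)%g v ->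
  (0 < J)%N -> (v ^+ J = 1)%g -> coarse_stab (440 * D) 1%g a v.
Proof.
move=> m0 mv J0 vJ; have [b_gp b_len] := good_pow m0.
have vl := torsion_len b_gp (axis_len b_gp b_len) mv J0 vJ.
apply: (good_pow_stab m0); split; first by rewrite mulg1; lra.
by rewrite mv distM; lra.
Qed.

(* Powers of v are powers both of a and of u a u^-1; if they were nontrivial, then
   comparing lengths u would commensurate a. So v is torsion. *)
Lemma common_axes_stab u v m m' : ~ commensurates a u ->
  (0 < m)%N -> intertwines (a ^+ m)%g (a ^+ m)%g v ->
  (0 < m')%N -> intertwines (a ^+ m')%g (a ^+ m')%g (u^-1 * v * u)%g ->
  coarse_stab (440 * D) 1%g a v.
Proof.
move=> u_nc m0 mv m0' mv'.
have [J J0 [i vJ]] := power_of_commuting m0 mv.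
have [J' J0' [i' vJ']] := power_of_commuting m0' mv'.
have conjX j : ((u^-1 * v * u) ^+ j = u^-1 * v ^+ j * u)%g.
  elim: j => [|j IH]; first by rewrite !expg0 mulg1 mulVg.
  by rewrite !expgSr IH !mulgA mulgK.
have vJ'E : (v ^+ J' = u * (u^-1 * v * u) ^+ J' * u^-1)%g.
  by rewrite conjX !mulgA mulgV mul1g mulgK.
case: (posnP i) => [i0|i0].
  apply: (commuting_torsion_stab m0 mv J0).
  by case: vJ => ->; rewrite i0 expg0 // invg1.
case: (posnP i') => [i0'|i0'].
  apply: (commuting_torsion_stab m0 mv J0'); rewrite vJ'E.
  by case: vJ' => ->; rewrite i0' expg0 ?invg1 mulg1 mulgV.
have [e [ea vE]] : exists e, (e = a \/ e = a^-1)%g /\ (v ^+ J = e ^+ i)%g.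
  case: vJ => ->; first by exists a; split=> //; left.
  by exists (a^-1)%g; rewrite expVgn; split=> //; right.
have [e' [ea' vE']] : exists e, (e = a \/ e = a^-1)%g /\ ((u^-1 * v * u) ^+ J' = e ^+ i')%g.
  case: vJ' => ->; first by exists a; split=> //; left.
  by exists (a^-1)%g; rewrite expVgn; split=> //; right.
have E : (u * e' ^+ (i' * J) = e ^+ (i * J') * u)%g.
  rewrite !expgnA -vE -vE' -!expgnA (mulnC J') conjX.
  by rewrite !mulgA mulgV mul1g.
have {E} [f [fa E]] : exists f, (f = a \/ f = a^-1)%g /\
    (u * a ^+ (i' * J) = f ^+ (i * J') * u)%g.
  case: ea' E => ->; first by move=> E; exists e.
  move=> E; exists e^-1%g; split.
    by case: ea => ->; [right|left; rewrite invgK].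
  rewrite !expVgn in E *; apply: (mulgI (e ^+ (i * J'))%g); rewrite mulVKg.
  by apply: (@mulIg _ (a ^- (i' * J))%g); rewrite -!mulgA mulgV mulg1 E.
have pq := conjugate_exponents fa E.
case: u_nc; exists (i' * J)%N; first by rewrite muln_gt0 i0' J0.
case: fa E => -> E; [left|right]; rewrite /intertwines E pq //.
by rewrite expVgn.
Qed.

Lemma commensuratesX m k f : (0 < k)%N -> normalizes (a ^+ m)%g f ->
  normalizes (a ^+ (m * k))%g f.
Proof.
move=> k0 [] /(intertwinesX k) h; [left|right]; rewrite /intertwines expgnA //.
by rewrite h expVgn.
Qed.

(** As S is finite, one power b of a is normalized by all letters, hence by G. Then [axis_reduce]
    and [normalizer_finite] provide finitely many coset representatives modulo b. *)
Lemma commensurated_virtually_cyclic (S : set G) : finite_generating_set S ->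
  (forall s, S s -> commensurates a s) -> virtually_cyclic G.
Proof.
move=> [/finite_seqP[ss sE] _ Sgen] Sc.
have [m m0 mS] : exists2 m, (0 < m)%N & forall s, s \in ss -> normalizes (a ^+ m)%g s.
  have : forall s, s \in ss -> commensurates a s by move=> s sss; apply: Sc; rewrite sE.
  elim: ss {sE} => [|s ss IH] h; first by exists 1%N.
  have [|m m0 mS] := IH; first by move=> t ts; apply: h; rewrite in_cons ts orbT.
  have [k k0 ks] := h s (mem_head _ _).
  exists (m * k)%N; first by rewrite muln_gt0 m0.
  move=> t; rewrite in_cons => /orP[/eqP->|ts]; last exact: commensuratesX (mS t ts).
  by rewrite mulnC; apply: commensuratesX ks.
have [b_gp b_len] := good_pow m0; set b := (a ^+ m)%g in mS b_gp b_len.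
have nG g : normalizes b g.
  have [n [w [_ wS ->]]] := Sgen g; elim: w wS => [|s w IH] wS.
    by rewrite big_nil; left; rewrite /intertwines mulg1 mul1g.
  rewrite big_cons.
  have ns : normalizes b s by apply: mS; have := wS s (mem_head _ _); rewrite sE.
  have {IH} nw : normalizes b (\prod_(a <- w) a)%g.
    by apply: IH => t tw; apply: wS; rewrite in_cons tw orbT.
  have comp h h' x y : intertwines h h' x -> intertwines b h y -> intertwines b h' (x * y)%g.
    by rewrite /intertwines => h1 h2; rewrite -mulgA h2 mulgA h1 mulgA.
  case: nw => nw; [have {}ns := ns | have {}ns := normalizesV ns].
    by case: ns => ns; [left|right]; apply: comp nw.
  case: ns => ns; [right|left]; apply: comp nw => //.
  by move: ns; rewrite invgK.
have [K HK] := normalizer_finite b_gp b_len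
  (d 1%g b + 2 * (20 * D) + 10 * D) (good_pow_card m0).
exists b, [set f | normalizes b f /\ d 1%g f <= d 1%g b + 2 * (20 * D) + 10 * D]%classic.
split; first exact: card_le_finite HK.
move=> g; have [z cz hz] := axis_reduce b_gp b_len (nG g).
exists (g * z)%g => //; rewrite invgM mulgVK.
exact: cyclic_subgroupV.
Qed.

End Good.

(** * The product inequality for balls *)

Section Counting.
Variables (N b1 : nat) (S : set G) (a s : G).
Hypothesis S_gen : finite_generating_set S.
Hypothesis a_good : good0 N a.
Hypothesis a_word : word_ball S b1 a.
Hypothesis Ss : S s.
Hypothesis s_nc : ~ commensurates a s.
Hypothesis S_len : forall x, S x -> d 1%g x <= 10 * d 1%g a.

Let axis_elt b := b = a \/ b = a^-1%g.

Lemma axis_elt_good b : axis_elt b ->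
  good0 N b /\ forall l, d 1%g (b ^+ l)%g = d 1%g (a ^+ l)%g.
Proof.
case=> -> //; split; first exact: (good_inv).
by move=> l; rewrite len_expV.
Qed.

Lemma axis_elt_inv b : axis_elt b -> axis_elt b^-1%g.
Proof. by case=> ->; [right|left; rewrite invgK]. Qed.

Lemma axis_elt_commute b k m : axis_elt b -> (a ^+ m * b ^+ k = b ^+ k * a ^+ m)%g.
Proof.
case=> ->; first exact: commuteX2.
by rewrite expVgn; apply: commuteV; apply: commuteX2.
Qed.

Lemma normalizes_axis_elt b c m g : axis_elt b -> axis_elt c ->
  (g * b ^+ m = c ^+ m * g)%g -> normalizes (a ^+ m)%g g.
Proof.
case=> ->; case=> -> h.
- by left.
- by right; rewrite /intertwines h expVgn.
- by right; have := intertwinesV h; rewrite expVgn invgK.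
- by left; have := intertwinesV h; rewrite !expVgn invgK.
Qed.

Lemma separator_not_commensurates b c : axis_elt b -> axis_elt c ->
  ~ commensurates a (separator N b c s).
Proof.
rewrite /separator; set k := sep_exp N => hb hc [m m0 h]; apply: s_nc; exists m => //.
have [e [he E]] : exists e, (e = a \/ e = a^-1)%g /\
    (b ^+ k * s * c ^+ k * a ^+ m = e ^+ m * (b ^+ k * s * c ^+ k))%g.
  case: h => h; first by exists a; split; [left|exact: h].
  by exists a^-1%g; split; [right|rewrite expVgn; exact: h].
apply: (@normalizes_axis_elt a e) => //; first by left.
apply: (mulgI (b ^+ k)%g); apply: (@mulIg _ (c ^+ k)%g).
have eb : (e ^+ m * b ^+ k = b ^+ k * e ^+ m)%g.
  case: he => ->; first exact: axis_elt_commute.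
  by rewrite expVgn; apply/commute_sym/commuteV/commute_sym/axis_elt_commute.
by rewrite -!mulgA (axis_elt_commute _ _ hc) !mulgA E !mulgA eb.
Qed.

Lemma separator_word b c : axis_elt b -> axis_elt c ->
  word_ball S (2 * (sep_exp N * b1) + 1) (separator N b c s).
Proof.
have aw x : axis_elt x -> word_ball S b1 x.
  by case=> -> //; apply: word_ball_inv.
move=> hb hc; have -> : (2 * (sep_exp N * b1) + 1 = sep_exp N * b1 + 1 + sep_exp N * b1)%N by lia.
apply: word_ball_mul; last by apply: word_ball_exp; apply: aw.
apply: word_ball_mul; first by apply: word_ball_exp; apply: aw.
exact: word_ball_letter.
Qed.

Lemma word_len m w : word_ball S m w -> d 1%g w <= 10 * d 1%g a * m%:R.
Proof.
move=> [t [tm tS ->]]; apply: (@le_trans _ _ (10 * d 1%g a * (size t)%:R)).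
  elim: t tS {tm} => [|x t IH] tS; first by rewrite big_nil dxx mulr0.
  rewrite big_cons /= -natr1.
  have := lenM x (\prod_(a <- t) a)%g.
  have := S_len (tS x (mem_head _ _)).
  by have := IH (fun y yt => tS y (@mem_behead _ (x :: t) y yt)); lra.
by rewrite ler_wpM2l ?ler_nat // mulr_ge0.
Qed.

(* Following w by a power of b creates almost no backtracking. *)
Definition exits m b w := word_ball S m w /\ gp 1%g w^-1%g b <= 19 * D.

(** By [direction] at w^-1, every w may be continued by a or by a^-1; the sign that suits more words
    suits at least half of them. *)
Lemma exits_half m : exists2 b, axis_elt b &
  exists W, [/\ uniq W, forall w, w \in W -> exits m b w
    & (ball_size S m <= 2 * size W)%N].
Proof.
pose W b : seq G := [seq w <- fset_set (word_ball S m) | `[< exits m b w >]].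
have inW b w : (w \in W b) = `[< exits m b w >].
  rewrite mem_filter; case: asboolP => //= -[h _].
  by rewrite in_fset_set; [exact/mem_set|exact: (word_ball_finite S_gen)].
have total : (ball_size S m <= size (W a) + size (W a^-1%g))%N.
  rewrite /ball_size -size_cat.
  apply: uniq_leq_size => // w; rewrite in_fset_set; last exact: (word_ball_finite S_gen).
  move=> /set_mem wS; rewrite mem_cat !inW.
  have [a_gp _ _] := a_good.
  have := direction w^-1%g a_gp.
  rewrite !(gpC d_hyp 1%g _ w^-1%g) => -[h|h]; apply/orP; [right|left];
    by apply/asboolP; split => //; lra.
have Wok b : uniq (W b) /\ forall w, w \in W b -> exits m b w.
  by split; [apply: filter_uniq; exact: fset_uniq|move=> w; rewrite inW => /asboolP].
case: (leqP (size (W a)) (size (W a^-1%g))) => h.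
  exists a^-1%g; first by right.
  exists (W a^-1%g); have [? ?] := Wok a^-1%g; split => //.
  by rewrite mul2n -addnn (leq_trans total) // leq_add2r.
exists a; first by left.
exists (W a); have [? ?] := Wok a; split => //.
by rewrite mul2n -addnn (leq_trans total) // leq_add2l ltnW.
Qed.

Section Fibers.
Variables b c : G.
Hypothesis (hb : axis_elt b) (hc : axis_elt c).

Let u := separator N b c^-1%g s.

Lemma separator_power i : (i <= N + 14)%N -> gp (b ^+ i)%g 1%g u <= 21 * D.
Proof.
have hc' := axis_elt_inv hc.
have [gb lb] := axis_elt_good hb; have [gc lc] := axis_elt_good hc'.
move=> iN; apply: (separator_gp gb gc) => //.
- by move=> l; rewrite lb lc.
- by have := lb 1%N; rewrite !expg1 => ->; apply: S_len.
move=> k k0; apply/eqP => e; apply: s_nc; exists k => //.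
by apply: (normalizes_axis_elt hc' (axis_elt_inv hb)).
Qed.

Lemma separator_inv_power i : (i <= N + 14)%N -> gp (c ^+ i)%g 1%g u^-1%g <= 21 * D.
Proof.
have hb' := axis_elt_inv hb.
have [gb lb] := axis_elt_good hb'; have [gc lc] := axis_elt_good hc.
have -> : (u^-1 = separator N c b^-1 s^-1)%g.
  by rewrite /u /separator !invgM -!expVgn !mulgA invgK.
move=> iN; apply: (separator_gp gc gb) => //.
- by move=> l; rewrite lb lc.
- by have := lc 1%N; rewrite !expg1 len_inv => ->; apply: S_len.
move=> k k0; apply/eqP => e; apply: s_nc; exists k => //.
apply: (normalizes_axis_elt (axis_elt_inv hc) hb').
by apply: (mulgI s^-1%g); apply: (@mulIg _ s^-1%g); rewrite mulKg -!mulgA mulgV mulg1 e.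
Qed.

(** By [decomposition_shift], v = w1^-1 w2 commutes with a power of a. The inverted equation is of
    the same kind, with u^-1 for u, so z1^-1 z2 = u^-1 v u also commutes with such a power, and
    [common_axes_stab] concludes. *)
Lemma fiber_diff m n w1 w2 z1 z2 :
  exits m b w1 -> exits m b w2 -> exits n c z1 -> exits n c z2 ->
  (w1 * u * z1^-1 = w2 * u * z2^-1)%g ->
  - (d 1%g a / 2) <= d 1%g w1 - d 1%g w2 <= d 1%g a / 2 ->
  coarse_stab (440 * D) 1%g a (w1^-1 * w2)%g.
Proof.
move=> [_ ew1] [_ ew2] [_ ez1] [_ ez2] e len12.
have [gb lb] := axis_elt_good hb; have [gc lc] := axis_elt_good hc.
have l0 := good_large a_good.
have lenb : d 1%g b = d 1%g a by have := lb 1%N; rewrite !expg1.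
have lenc : d 1%g c = d 1%g a by have := lc 1%N; rewrite !expg1.
have dirb w : gp 1%g w^-1%g b <= 19 * D -> gp 1%g w^-1%g u <= 20 * D.
  exact: (separator_direction gb separator_power).
have dirc z : gp 1%g z^-1%g c <= 19 * D -> gp 1%g u^-1%g z^-1%g <= 20 * D.
  move=> h; rewrite (gpC d_hyp).
  exact: (separator_direction gc separator_inv_power).
have prod_len w z : gp 1%g w^-1%g b <= 19 * D -> gp 1%g z^-1%g c <= 19 * D ->
    d 1%g w + d 1%g u + d 1%g z - 41 * D <= d 1%g (w * u * z^-1)%g
      <= d 1%g w + d 1%g u + d 1%g z.
  move=> hw hz; have := dirb w hw; have h := dirc z hz.
  have [|_] := separator_concat gb separator_power
     (P := w^-1%g) (Q := (u * z^-1)%g) (dirb w hw); first by rewrite mulKg.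
  have -> : d 1%g (w * u * z^-1)%g = d w^-1%g (u * z^-1)%g.
    by rewrite -(dL w^-1%g) mulg1 -mulgA mulKg.
  rewrite /dgp (dC (u * z^-1)%g u) distM (dC w^-1%g 1%g) !len_inv (dC u 1%g).
  have := d_tri w^-1%g 1%g (u * z^-1)%g; have := lenM u z^-1%g.
  rewrite (dC w^-1%g 1%g) !len_inv; lra.
have [m1 [m10 _ e1]] := decomposition_shift gb separator_power e ew1 ew2
    (dirc _ ez1) (dirc _ ez2) ltac:(rewrite lenb; lraD).
have p1 := prod_len w1 z1 ew1 ez1; have p2 := prod_len w2 z2 ew2 ez2.
have e' : (z1 * u^-1 * w1^-1 = z2 * u^-1 * w2^-1)%g.
  have inv3 (x y z : G) : ((x * y^-1 * z^-1)^-1 = z * y * x^-1)%g by rewrite !invgM !invgK mulgA.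
  by apply: invg_inj; rewrite !inv3.
have dirb' w : gp 1%g w^-1%g b <= 19 * D -> gp 1%g (u^-1)^-1%g w^-1%g <= 20 * D.
  by move=> h; rewrite invgK (gpC d_hyp); exact: dirb.
(* Half the length of a, allowed between w1 and w2, plus the error 41 D of [prod_len] is at most the
   length of a, itself at least 100 D. *)
have lz : - d 1%g c <= d 1%g z1 - d 1%g z2 <= d 1%g c.
  by rewrite lenc; rewrite e in p1; lraD.
have [m2 [m20 _ e2]] := decomposition_shift gc separator_inv_power e' ez1 ez2
    (dirb' _ ew1) (dirb' _ ew2) lz.
have conj : (z1^-1 * z2 = u^-1 * (w1^-1 * w2) * u)%g.
  apply: (mulgI (w1 * u)%g); rewrite mulgA e.
  by clearbody u; rewrite !mulgA !mulgK mulgVK mulgV mul1g.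
have comm x k v : axis_elt x -> (x ^+ k * v = v * x ^+ k)%g ->
    intertwines (a ^+ k)%g (a ^+ k)%g v.
  case=> -> //; rewrite expVgn => h; have := intertwinesV (esym h).
  by rewrite !invgK.
apply: (common_axes_stab a_good
  (separator_not_commensurates hb (axis_elt_inv hc)) m10 (comm _ _ _ hb e1) m20).
by rewrite -conj; apply: comm hc e2.
Qed.

End Fibers.

(* The map sends (w, z) to w u z^-1; within a fiber, w is located by its length
   up to a window of half the length of a, and 20 m + 1 windows suffice. *)
Lemma ball_product m n :
  (ball_size S m * ball_size S n <=
    4 * ((20 * m + 1) * N) * ball_size S (m + n + (2 * (sep_exp N * b1) + 1)))%N.
Proof.
have [b hb [W [uW WS Wm]]] := exits_half m.
have [c hc [Z [uZ ZS Zn]]] := exits_half n.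
set u := separator N b c^-1%g s; set k := (m + n + _)%N.
have l0 := good_large a_good.
have la : 0 < d 1%g a by lraD.
pose phi (x : G * G) := (x.1 * u * x.2^-1)%g.
pose A x := exits m b x.1 /\ exits n c x.2.
pose B : seq G := fset_set (word_ball S k).
have phiB x : A x -> phi x \in B.
  move=> [[wS _] [zS _]]; rewrite in_fset_set; last exact: (word_ball_finite S_gen).
  apply/mem_set; rewrite /k addnAC /phi; apply: word_ball_mul; last exact: (word_ball_inv S_gen).
  by apply: word_ball_mul => //; apply: separator_word => //; apply: axis_elt_inv.
have cardA : card_le A (size B * ((20 * m + 1) * N)).
  apply: (card_le_fibers (idx := fun x => index (phi x) B)) => [x Ax|i].
    by rewrite index_mem; apply: phiB.
  apply: (card_le_fibers
    (idx := fun x => Num.truncn (d 1%g x.1 / (d 1%g a / 2)))) => [x [[[wS _] _] _]|j].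
    rewrite addn1 ltnS -(ler_nat R).
    apply: (@le_trans _ _ (d 1%g x.1 / (d 1%g a / 2))).
      by rewrite truncn_le divr_ge0 // divr_ge0.
    rewrite ler_pdivrMr ?divr_gt0 //; have := word_len wS; rewrite natrM; lra.
  have [_ _ aN] := a_good.
  have : card_le (fun w => exists z, (A (w, z) /\ phi (w, z) = nth 1%g B i) /\
      Num.truncn (d 1%g w / (d 1%g a / 2)) = j) N.
    apply: card_le_diff aN => w1 w2 [z1 [[[A1 A1'] p1] t1]] [z2 [[[A2 A2'] p2] t2]].
    apply: (fiber_diff hb hc A1 A2 A1' A2'); first exact: etrans p1 (esym p2).
    have tr w : Num.truncn (d 1%g w / (d 1%g a / 2)) = j ->
        d 1%g a / 2 * j%:R <= d 1%g w < d 1%g a / 2 * j%:R + d 1%g a / 2.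
      move=> <-; have /truncn_itv : 0 <= d 1%g w / (d 1%g a / 2) by rewrite divr_ge0 // divr_ge0.
      set t := Num.truncn _; rewrite ler_pdivlMr ?divr_gt0 // ltr_pdivrMr ?divr_gt0 //.
      by rewrite -natr1 => /andP[? ?]; apply/andP; split; lra.
    by move: (tr _ t1) (tr _ t2); lra.
  apply: card_le_inj (fun x => x.1) _ _.
    move=> [w z] [w' z'] [[/= Ax e] _] [[/= Ax' e'] _] /= ww.
    have : phi (w, z) = phi (w', z').
      rewrite -(nth_index 1%g (phiB _ Ax)) -(nth_index 1%g (phiB _ Ax')).
      by rewrite e e'.
    by rewrite /phi /= ww => /mulgI /invg_inj ->.
  move=> [w z] [[/= Ax e] t]; exists z; split => //; split => //.
  by rewrite -e nth_index //; apply: phiB.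
have := cardA [seq (w, z) | w <- W, z <- Z].
rewrite allpairs_uniq //; last by move=> [? ?] [? ?].
move=> /(_ isT); rewrite size_allpairs => H.
have {}H : (size W * size Z <= size B * ((20 * m + 1) * N))%N.
  by apply: H => x /allpairsP[[w z] [wW zZ ->]]; split; [exact: WS|exact: ZS].
apply: (leq_trans (leq_mul Wm Zn)).
have -> : (2 * size W * (2 * size Z) = 4 * (size W * size Z))%N by lia.
by rewrite -[leqRHS]mulnA leq_mul2l /= (mulnC _ (ball_size S k)); exact: H.
Qed.

End Counting.

(** * Building a good element with controlled letters *)

Lemma word_chain (c : R) (x0 : G) (w : seq G) : 0 <= c ->
  sorted (fun u v => gp 1%g u^-1%g v <= c) w -> all (fun u => c + 2 * D <= d 1%g u) w ->
  forall i j k, (i <= j)%N -> (j <= k)%N -> (k <= size w)%N ->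
  gp (\prod_(u <- take j w) u)%g (\prod_(u <- take i w) u)%g (\prod_(u <- take k w) u)%g
    <= c + 2 * D.
Proof.
move=> c0 /(sortedP x0) sw /(all_nthP x0) aw i j k ij jk kw.
have XS l : (l < size w)%N ->
    (\prod_(u <- take l.+1 w) u = (\prod_(u <- take l w) u) * nth x0 w l)%g.
  by move=> lw; rewrite (take_nth x0) // -cats1 big_cat /= big_seq1.
apply: (@chain_gp _ _ D d d_hyp D_gt0 (fun i => \prod_(u <- take i w) u)%g c (size w)) => //.
  move=> l lw; rewrite (XS l.+1) // (XS l) ?(ltnW lw) //.
  set X := (\prod_(u <- take l w) u)%g.
  by rewrite -(gpL (X * nth x0 w l)^-1%g) mulVg mulKg invgM mulgVK; apply: sw.
by move=> l lw; rewrite XS // distM; apply: aw.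
Qed.

(** The doubled word also controls the turn from the last letter to the first, hence the powers of
    the product A. The first letter z is near [1, A] and hands its WPD bound to A through
    [coarse_stab_between]; the last letter p makes A long, 118 D leaving 100 D. *)
Lemma loop_good N z us p : let w := z :: rcons us p in
  sorted (fun u v => gp 1%g u^-1%g v <= 16 * D) (w ++ w) ->
  all (fun u => 118 * D <= d 1%g u) w ->
  card_le (coarse_stab (3 * (440 * D) + 18 * D + D) 1%g z) N ->
  good0 N (\prod_(u <- w) u)%g /\ d 1%g p - 18 * D <= d 1%g (\prod_(u <- w) u)%g.
Proof.
move=> w sw aw zN.
have c0 : 0 <= 16 * D by lraD.
have cE : 16 * D + 2 * D = 18 * D by lra.
have lw : (size w = (size us).+2)%N by rewrite /= size_rcons.
have big_ u : 118 * D <= d 1%g u -> 16 * D + 2 * D <= d 1%g u by lraD.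
have aww : all (fun u => 16 * D + 2 * D <= d 1%g u) (w ++ w).
  by rewrite all_cat andbb; apply: sub_all aw => u; apply: big_.
have C := word_chain 1%g c0 sw aww; rewrite cE in C.
set A := (\prod_(u <- w) u)%g.
have t0 : take 0 (w ++ w) = [::] by rewrite take0.
have tw : take (size w) (w ++ w) = w by rewrite take_size_cat.
have tww : take (size (w ++ w)) (w ++ w) = w ++ w by rewrite take_size.
have t1 : take 1 (w ++ w) = [:: z] by rewrite /= take0.
have tp : take (size w).-1 (w ++ w) = z :: us.
  by rewrite lw /= -cats1 -catA take_size_cat.
have AE : A = ((\prod_(u <- z :: us) u) * p)%g.
  by rewrite /A /w -rcons_cons -cats1 big_cat /= big_seq1.
have gA : gp 1%g A^-1%g A <= 18 * D.
  have := C 0%N (size w) (size (w ++ w)) isT.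
  rewrite t0 tw tww big_cat /= big_nil -/A size_cat leq_addr leqnn => /(_ isT isT).
  by rewrite -(gpL A^-1%g) mulg1 mulVg mulKg.
have gp_ : gp (\prod_(u <- z :: us) u)%g 1%g A <= 18 * D.
  have := C 0%N (size w).-1 (size w) isT.
  rewrite t0 tw tp big_nil -/A size_cat leq_addr leq_pred => H; exact: H.
have gz : gp z 1%g A <= 18 * D.
  have := C 0%N 1%N (size w) isT.
  rewrite t0 tw t1 big_nil big_seq1 -/A size_cat leq_addr lw => H; exact: H.
have lp : d 1%g p - 18 * D <= d 1%g A.
  have e : d (\prod_(u <- z :: us) u)%g A = d 1%g p by rewrite AE distM.
  move: gp_; rewrite /dgp (dC A) e.
  by have := d_ge0 1%g (\prod_(u <- z :: us) u)%g; lra.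
split => //; split => //.
  suff : 118 * D <= d 1%g p by lraD.
  by move/allP: aw; apply; rewrite /w in_cons mem_rcons in_cons eqxx orbT.
apply: card_le_sub zN => v; exact: (coarse_stab_between gz).
Qed.

(* If s and s^-1 both sent 1 in the direction of z, past almost all of [1, z], then
   s would move z less than r - D. *)
Lemma exit_elt (S : set G) (r : R) z s : finite_generating_set S ->
  gp 1%g z^-1%g z <= 15 * D -> 100 * D <= d 1%g z -> 10 * d 1%g z < r ->
  (forall x, S x -> d 1%g x <= r) -> S s -> r - D < d z (s * z)%g ->
  exists2 x, S x & gp 1%g (x * z)^-1%g z <= 16 * D /\ r - 3 * d 1%g z <= d 1%g (x * z)%g.
Proof.
move=> [_ SV _] z_gp z_len r_big S_len Ss s_far.
have key x : S x -> d 1%g s <= d 1%g x -> gp 1%g z x^-1%g <= 2 * d 1%g z - 17 * D ->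
    exists2 x, S x & gp 1%g (x * z)^-1%g z <= 16 * D /\ r - 3 * d 1%g z <= d 1%g (x * z)%g.
  move=> Sx sx h; exists x => //; split.
    rewrite invgM -(gpL z) mulg1 mulVKg.
    have g2 : gp z 1%g (z * z)%g <= 15 * D.
      by rewrite -(gpL z^-1%g) mulVg mulg1 mulKg.
    have := gp_4pt d_hyp z 1%g x^-1%g (z * z)%g.
    have := gp_flip d_hyp 1%g z x^-1%g.
    by move=> ? [] ?; lraD.
  have e : d 1%g (x * z)%g = d x^-1%g z by rewrite -(dL x^-1%g) mulg1 mulKg.
  have xV := len_inv x.
  have t1 := d_tri z 1%g (s * z)%g; have t2 := lenM s z.
  move: h; rewrite e /dgp (dC z 1%g) (dC x^-1%g 1%g) (dC z x^-1%g).
  by rewrite (dC z 1%g) in t1; lraD.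
case: (leP (gp 1%g z s^-1%g) (2 * d 1%g z - 17 * D)) => h1; first exact: (key s).
case: (leP (gp 1%g z s) (2 * d 1%g z - 17 * D)) => h2.
  by apply: (key s^-1%g); [exact: SV|rewrite len_inv|rewrite invgK].
exfalso.
have e : d 1%g (s * z)%g = d s^-1%g z by rewrite -(dL s^-1%g) mulg1 mulKg.
have es : d s (s * z)%g = d 1%g z := distM s z.
have sV := len_inv s; have sr := S_len s Ss.
have s0 := d_ge0 1%g s.
move: h1 h2; rewrite /dgp (dC z 1%g) (dC s^-1%g 1%g) (dC z s^-1%g) (dC s 1%g) => h1 h2.
have := dist_4pt d_hyp z 1%g (s * z)%g s.
by rewrite (dC z 1%g) (dC (s * z)%g s) => -[] ?; lraD.
Qed.

(** By [exit_elt], p = x g may be followed by g and q = y g^-1 by g^-1. By [direction], p may be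
    preceded by g or by g^-1, and so may q. Hence one of the cyclic words g p, g^-1 q, g q g^-1 p
    has almost no backtracking. *)
Lemma good_of_far_letters N (b0 : nat) (S : set G) (r : R) g : finite_generating_set S ->
  word_ball S b0 g -> gp 1%g g^-1%g g <= 15 * D -> 200 * D <= d 1%g g ->
  card_le (coarse_stab (3 * (440 * D) + 18 * D + D) 1%g g) N ->
  (forall x, S x -> d 1%g x <= r) -> 10 * d 1%g g < r ->
  (exists2 s, S s & r - D < d g (s * g)%g) ->
  (exists2 s, S s & r - D < d g^-1%g (s * g^-1)%g) ->
  exists a, [/\ word_ball S (4 * b0 + 2) a, good0 N a & forall x, S x -> d 1%g x <= 10 * d 1%g a].
Proof.
have n1 : (b0 + (1 + b0) <= 4 * b0 + 2)%N by lia.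
have n2 : (b0 + ((1 + b0) + (b0 + (1 + b0))) <= 4 * b0 + 2)%N by lia.
move=> S_gen gw g_gp g_len gN S_len r_big [s Ss sfar] [s' Ss' s'far].
have gwV := word_ball_inv S_gen gw.
have lV := len_inv g.
have gV_gp : gp 1%g (g^-1)^-1%g g^-1%g <= 15 * D by rewrite invgK (gpC d_hyp).
have gVN : card_le (coarse_stab (3 * (440 * D) + 18 * D + D) 1%g g^-1%g) N.
  apply: coarse_stab_sym; have := coarse_stab_translate (g := g^-1%g) gN.
  by rewrite mulg1 mulVg.
have g_len' : 100 * D <= d 1%g g by lraD.
have [x Sx [x_exit x_len]] := exit_elt S_gen g_gp g_len' r_big S_len Ss sfar.
have [y Sy [y_exit y_len]] : exists2 y, S y &
    gp 1%g (y * g^-1)^-1%g g^-1%g <= 16 * D /\ r - 3 * d 1%g g <= d 1%g (y * g^-1)%g.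
  have := @exit_elt S r g^-1%g s' S_gen gV_gp; rewrite lV; exact.
set p := (x * g)%g in x_exit x_len; set q := (y * g^-1)%g in y_exit y_len.
have pw : word_ball S (1 + b0) p.
  by apply: word_ball_mul => //; apply: word_ball_letter.
have qw : word_ball S (1 + b0) q.
  by apply: word_ball_mul => //; apply: word_ball_letter.
have p_len : 118 * D <= d 1%g p by lraD.
have q_len : 118 * D <= d 1%g q by lraD.
have g118 : 118 * D <= d 1%g g by lraD.
have g118' : 118 * D <= d 1%g g^-1%g by rewrite lV.
(* With |g| for the length of g, 10 (r - 3 |g| - 18 D) is at least r, because r > 10 |g| and |g| >=
   200 D. *)
have fin (A v : G) : good0 N A -> r - 3 * d 1%g g <= d 1%g v -> d 1%g v - 18 * D <= d 1%g A ->
    forall x, S x -> d 1%g x <= 10 * d 1%g A.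
  by move=> _ h1 h2 t /S_len h3; lraD.
have [p_in|p_in] := direction p g_gp.
  have [||ga la] := @loop_good N g [::] p _ _ gN.
  - by rewrite /= ?invgK; apply/and4P; split => //; lraD.
  - by rewrite /= p_len g118.
  exists (\prod_(u <- g :: rcons [::] p) u)%g; split; [|exact: ga|exact: (fin _ _ ga x_len la)].
  rewrite /= big_cons big_seq1; apply: (word_ball_leq n1).
  exact: word_ball_mul.
have [q_in|q_in] := direction q g_gp; last first.
  have [||ga la] := @loop_good N g^-1%g [::] q _ _ gVN.
  - by rewrite /= ?invgK; apply/and4P; split => //; lraD.
  - by rewrite /= q_len g118'.
  exists (\prod_(u <- g^-1%g :: rcons [::] q) u)%g; split; [|exact: ga|exact: (fin _ _ ga y_len la)].
  rewrite /= big_cons big_seq1; apply: (word_ball_leq n1).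
  exact: word_ball_mul.
have [||ga la] := @loop_good N g [:: q; g^-1%g] p _ _ gN.
- rewrite /= ?invgK.
  have [h1 h2] : gp 1%g g^-1%g q <= 16 * D /\ gp 1%g g p <= 16 * D by split; lra.
  by rewrite h1 h2 x_exit y_exit.
- by rewrite /= p_len q_len g118 g118'.
exists (\prod_(u <- g :: rcons [:: q; g^-1%g] p) u)%g; split; [|exact: ga|exact: (fin _ _ ga x_len la)].
rewrite /= !big_cons big_nil mulg1.
apply: (word_ball_leq n2).
by do 3 apply: word_ball_mul => //.
Qed.

End LeftInvariant.

(* The base point is moved within the orbit of the centralizer of g so as to
   almost minimize the largest displacement of a letter. *)
Lemma good_adapted (R : realType) (G : groupType) (D : R) (d : G -> G -> R) (N b0 : nat)
    (S : set G) (g : G) :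
  hyperbolic_dist D d -> 0 < D -> (forall g u v, d (g * u)%g (g * v)%g = d u v) ->
  finite_generating_set S -> word_ball S b0 g ->
  dgp d 1%g g^-1%g g <= 15 * D -> 200 * D <= d 1%g g ->
  card_le (coarse_stab d (3 * (440 * D) + 18 * D + D) 1%g g) N ->
  exists d', [/\ hyperbolic_dist D d', forall g u v, d' (g * u)%g (g * v)%g = d' u v
    & exists a, [/\ word_ball S (4 * b0 + 2) a,
        good d' (18 * D) (100 * D) (440 * D) N a
      & forall x, S x -> d' 1%g x <= 10 * d' 1%g a]].
Proof.
have n0 : (b0 <= 4 * b0 + 2)%N by lia.
move=> d_hyp D_gt0 dL S_gen gw g_gp g_len gN.
pose base t u v := d (u * t)%g (v * t)%g.
have base_hyp t : hyperbolic_dist D (base t).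
  by case: d_hyp => h1 h2 h3 h4; split => *; [exact: h1|exact: h2|exact: h3|exact: h4].
have base_L t h u v : base t (h * u)%g (h * v)%g = base t u v by rewrite /base -!mulgA dL.
(* For t in the centralizer of g, moving the base point by t changes no distance between powers of
   g, so the hypotheses on g persist. *)
have baseE t u v : commute g t -> cyclic_subgroup g u -> cyclic_subgroup g v ->
    base t u v = d u v.
  have ct w : commute g t -> cyclic_subgroup g w -> (w * t = t * w)%g.
    move=> gt [n [->|->]]; first exact/commute_sym/commuteX/commute_sym.
    exact/commute_sym/commuteV/commuteX/commute_sym.
  by move=> gt cu cv; rewrite /base !ct // dL.
pose Q := [set r : R | 0 <= r /\ exists2 t, commute g t & forall s, S s -> base t 1%g s <= r]%classic.
have c1 : cyclic_subgroup g 1%g by exists 0%N; left; rewrite expg0.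
have cg : cyclic_subgroup g g by exists 1%N; left; rewrite expg1.
have cV : cyclic_subgroup g g^-1%g by exists 1%N; right; rewrite expg1.
have Qinf : has_inf Q.
  split; last by exists 0 => r [].
  have [Sfin _ _] := S_gen; have [ss sE] := (finite_seqP S).1 Sfin.
  exists (\sum_(s <- ss) d 1%g s); split.
    by apply: sumr_ge0 => s _; apply: dist_ge0 d_hyp _ _.
  exists 1%g; first exact: commute1.
  rewrite sE => s /= sss; rewrite /base !mulg1 (big_rem s) //= lerDl.
  by apply: sumr_ge0 => t _; apply: dist_ge0 d_hyp _ _.
have [r [r0 [t gt tr]] rinf] := inf_adherent D_gt0 Qinf.
have notQ : ~ Q (r - D).
  by move=> /(ge_inf Qinf.2); lra.
exists (base t); split => //.
have lg : base t 1%g g = d 1%g g by apply: baseE.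
have gp_t : dgp (base t) 1%g g^-1%g g <= 15 * D by rewrite /dgp !baseE.
have gN_t : card_le (coarse_stab (base t) (3 * (440 * D) + 18 * D + D) 1%g g) N.
  apply: (@card_le_inj _ _ _ _ _ (fun h => t^-1 * h * t)%g) gN.
    by move=> x y _ _ /mulIg /mulgI.
  move=> h [h1 h2]; split.
    rewrite -(dL t) !mulgA mulgV mul1g !mulg1.
    by move: h1; rewrite /base mul1g mulg1.
  rewrite -(dL t) !mulgA mulgV mul1g -!mulgA -gt.
  by move: h2; rewrite /base mulgA.
case: (leP r (10 * d 1%g g)) => r_big.
  exists g; split.
  - exact: word_ball_leq gw.
  - split; [lra|rewrite lg; lra|].
    by apply: (coarse_stab_le (e := 3 * (440 * D) + 18 * D + D)) => //; lra.
  - by move=> x /tr h; rewrite lg; lra.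
(* The base point z t is again admissible and r - D is below the infimum, so some letter moves it by
   more than r - D. *)
have far z : cyclic_subgroup g z -> exists2 s, S s & r - D < base t z (s * z)%g.
  move=> cz; have gz : commute g z.
    by case: cz => n [->|->]; [exact: commuteX|apply: commuteV; exact: commuteX].
  apply: contrapT => h; apply: notQ; split.
    by have := g_len; have := D_gt0; lra.
  exists (z * t)%g; first exact: commuteM.
  move=> s Ss; rewrite leNgt; apply/negP => hs; apply: h; exists s => //.
  by move: hs; rewrite /base mul1g mulgA.
apply: (good_of_far_letters (base_hyp t) D_gt0 (base_L t) S_gen gw gp_t _ gN_t tr).
- by rewrite lg.
- by rewrite lg.
- exact: far.
- exact: far.
Qed.

(** * Axes and WPD elements *)

(** Seen from a far point P of the axis of h, [dist_shift] makes the steps from f^-1 to 1 and from 1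
    to f equal up to D; so f and f^-1 lie on opposite sides of 1, about equally far. This serves for
    f a power of g and h a longer one carrying the axis. *)
Lemma commuting_gp (R : realType) (G : groupType) (D : R) (d : G -> G -> R) (h f : G) :
  hyperbolic_dist D d -> 0 < D -> (forall g u v, d (g * u)%g (g * v)%g = d u v) ->
  dgp d 1%g h^-1%g h <= 2 * D -> 5 * D <= d 1%g h -> commute h f ->
  dgp d 1%g f^-1%g f <= 15 * D.
Proof.
move=> d_hyp D_gt0 dL h_gp h_len hf.
have h_len' : 2 * D + 3 * D <= d 1%g h by lra.
have [M1 HM1] := axis_gp d_hyp D_gt0 dL h_gp h_len' (d 1%g f).
have [M2 HM2] := pow_unbounded d_hyp D_gt0 dL h_gp h_len' (3 * d 1%g f + D).
set M := maxn M1 M2; have {HM1} axis := HM1 M (leq_maxl _ _).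
have {HM2} lM := HM2 M (leq_maxr _ _).
have fV := len_inv d_hyp dL f.
set P := (h ^- M)%g in axis; set Q := (h ^+ M)%g in axis lM.
have lP : d 1%g P = d 1%g Q by rewrite /P (len_inv d_hyp dL).
have T1 : dgp d 1%g P Q <= 6 * D.
  have -> : 6 * D = 2 * D + 4 * D by lra.
  apply: axis; first by rewrite (distxx d_hyp); apply: dist_ge0 d_hyp _ _.
  by left; rewrite /intertwines mulg1 mul1g.
have Tf : dgp d f P Q <= 6 * D.
  have -> : 6 * D = 2 * D + 4 * D by lra.
  by apply: axis => //; left; exact: esym hf.
have f0 := dist_ge0 d_hyp 1%g f.
set P' := (f * P)%g.
have PP' : d P P' <= d 1%g f.
  have -> : P' = (P * f)%g by apply: commuteV; apply: commuteX; apply: commute_sym.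
  by rewrite (distM dL).
have e1 : d P f^-1%g = d P' 1%g by rewrite -(dL f) mulgV.
have e2 : d P 1%g = d P' f by rewrite -(dL f) mulg1.
have tf := dist_tri d_hyp 1%g f P.
have C1 := distC d_hyp P 1%g; have C2 := distC d_hyp f P; have C3 := distC d_hyp f 1%g.
have p1 := dist_ge0 d_hyp P' 1%g; have p2 := dist_ge0 d_hyp P' f.
have s1 : d P f + d P' 1%g <= d P 1%g + d P' f + D.
  by apply: (dist_shift d_hyp PP'); lra.
have s2 : d P 1%g + d P' f <= d P f + d P' 1%g + D.
  by apply: (dist_shift d_hyp PP'); lra.
have n1 r : d P 1%g - d P f <= r -> d P f - d P 1%g <= r -> d 1%g f <= r + 6 * D + D.
  exact: (gp_near d_hyp T1 Tf).
have t1 := dist_tri d_hyp P f^-1%g f; have t2 := dist_tri d_hyp P f f^-1%g.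
have C4 := distC d_hyp f^-1%g 1%g; have C5 := distC d_hyp f f^-1%g.
clear axis.
rewrite /dgp; case: (leP (d P 1%g) (d P f)) => h1.
  by have := n1 (d P f - d P 1%g) ltac:(lra) ltac:(lra); lra.
by have := n1 (d P 1%g - d P f) ltac:(lra) ltac:(lra); lra.
Qed.

Lemma discrete_ivt (R : realType) (f : nat -> R) (r : R) (n : nat) :
  f 0%N <= r -> r <= f n -> (0 < n)%N ->
  exists2 i, (i < n)%N & f i <= r <= f i.+1.
Proof.
case: n => // n f0 fn _; elim: n fn => [|n IH] fn; first by exists 0%N; rewrite ?f0.
have [h|h] := leP r (f n.+1).
  by have [i i_n hi] := IH h; exists i => //; apply: ltn_trans i_n _.
by exists n.+1 => //; rewrite (ltW h).
Qed.

Lemma card_le_fset (T : choiceType) (A : set T) (r : realType) (c : r) :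
  finite_set A -> #|` fset_set A|%:R <= c -> card_le A (Num.truncn c).
Proof.
move=> Afin Ac s us sA.
rewrite truncn_ge_nat; last by apply: le_trans Ac.
apply: le_trans Ac; rewrite ler_nat; apply: uniq_leq_size => // x xs.
by rewrite in_fset_set // inE; apply: sA.
Qed.

Section Axes.
Context {R : realType} {X : metricType R} {G : groupType}.
Variables (act : G -> X -> X) (delta : R).
Hypothesis delta_gt0 : 0 < delta.
Hypothesis X_hyp : gromov_hyperbolic X delta.
Hypothesis act_isom : isometric_action act.
Implicit Types (g h : G) (x y : X).

Lemma mdist_hyp : hyperbolic_dist (2 * delta) (@mdist R X).
Proof.
have [_ X4] := X_hyp.
split; [exact: mdistxx|exact: metric_sym|exact: metric_triangle|].
move=> x y z w; have := X4 w x y z; rewrite /gromov_product lerBlDr ge_min.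
by move=> /orP[] h; [left|right]; lra.
Qed.

Definition orbit_dist x u v := mdist (act u x) (act v x).

Local Notation d := orbit_dist.

Lemma orbit_hyp x : hyperbolic_dist (2 * delta) (d x).
Proof.
by case: mdist_hyp => h1 h2 h3 h4; split => *; [exact: h1|exact: h2|exact: h3|exact: h4].
Qed.

Lemma orbit_dL x g u v : d x (g * u)%g (g * v)%g = d x u v.
Proof. by have [_ h2 h3] := act_isom; rewrite /orbit_dist !h2 h3. Qed.

Lemma orbit_d1 x g : d x 1%g g = mdist x (act g x).
Proof. by have [h1 _ _] := act_isom; rewrite /orbit_dist h1. Qed.

(** The default value of [translation_length] is 0, so a positive value is a genuine limit. *)
Lemma hyperbolic_eltE g x : hyperbolic_elt act g ->
  (fun n => mdist x (act (g ^+ n)%g x) / n%:R) @ \oo --> translation_length act g.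
Proof.
rewrite /hyperbolic_elt /translation_length => h0.
set L := [set l : R | _] in h0 *.
have [[l Ll]|noL] := pselect (exists l, L l).
  exact: (@xgetPex _ 0 L (ex_intro _ l Ll)).
by move: h0; rewrite xgetPN ?ltxx // => l Ll; apply: noL; exists l.
Qed.

(** If it failed, subadditivity along the multiples of j would keep the quotients away from the
    limit. *)
Lemma translation_length_le g x j : hyperbolic_elt act g ->
  translation_length act g * j%:R <= d x 1%g (g ^+ j)%g.
Proof.
move=> /(hyperbolic_eltE x); set l := translation_length act g => cvg_l.
have [->|j0] := posnP j; first by rewrite mulr0; apply: dist_ge0 (orbit_hyp x) _ _.
have j0' : 0 < j%:R :> R by rewrite ltr0n.
rewrite leNgt; apply/negP => lt_l.
have e0 : 0 < l - d x 1%g (g ^+ j)%g / j%:R by rewrite subr_gt0 ltr_pdivrMr.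
move/cvgrPdist_lt: cvg_l => /(_ _ e0) [N _ HN].
have := HN (j * N.+1)%N; rewrite /= => /(_ (leq_trans (leqnSn N) (leq_pmull _ j0))).
rewrite -orbit_d1 ltNge => /negP; apply.
apply: le_trans (ler_norm _); rewrite lerD2l lerNr opprK.
rewrite natrM invfM mulrA ler_pdivrMr ?ltr0n // mulrAC ler_wpM2r ?invr_ge0 ?ler0n //.
rewrite expgnA; have := pow_len_upper (orbit_hyp x) (@orbit_dL x) (g ^+ j)%g N.+1.
done.
Qed.

Lemma hyperbolic_elt_inj g i j : X -> hyperbolic_elt act g -> (i < j)%N -> (g ^+ i <> g ^+ j)%g.
Proof.
move=> x hg ij e.
have := translation_length_le x (j - i) hg.
have -> : (g ^+ (j - i) = 1)%g.
  by apply: (mulgI (g ^+ i)%g); rewrite mulg1 -expgnDr subnKC // ltnW.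
rewrite (distxx (orbit_hyp x)) leNgt => /negP; apply.
by rewrite mulr_gt0 // ltr0n subn_gt0.
Qed.

(* The midpoint of [x, h x] is moved by at least the displacement of h, so there is
   almost no backtracking at h x. *)
Lemma displacement_gp h x c : 10 * delta <= displacement act h ->
  mdist x (act h x) = displacement act h -> geodesic_segment x (act h x) c ->
  dgp (d x) 1%g h^-1%g h <= 2 * (2 * delta).
Proof.
have [act1 actM actd] := act_isom; have Hd := mdist_hyp; have de0 := delta_gt0.
set L := displacement act h => L_ge xL [c0 c1 cd].
rewrite -(gpL (@orbit_dL x) h) mulg1 mulgV /dgp /orbit_dist act1 actM.
set z := act h x in xL c0 c1 cd *; set w := act h z.
have L0 : 0 <= L by lra.
pose m := c (L / 2); pose m' := act h m.
have in0 : 0 \in `[0, mdist x z] by rewrite in_itv /= lexx xL.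
have inL : L \in `[0, mdist x z] by rewrite in_itv /= xL lexx L0.
have inm : L / 2 \in `[0, mdist x z] by rewrite in_itv /= xL; apply/andP; split; lra.
have xm : mdist x m = L / 2.
  by rewrite -c0 /m cd // distrC subr0 ger0_norm //; lra.
have mz : mdist m z = L / 2.
  by rewrite -c1 xL /m cd // distrC ger0_norm; lra.
have zm' : mdist z m' = L / 2 by rewrite /z /m' actd.
have m'w : mdist m' w = L / 2 by rewrite /w /m' actd.
have zw : mdist z w = L by rewrite /w {1}/z actd.
have mm' : L <= mdist m m'.
  apply: ge_inf; last by exists m.
  by exists 0 => _ [y _ <-]; exact: mdist_ge0.
have := gp_4pt Hd z m x m'; have := gp_4pt Hd z x w m'.
rewrite /dgp (metric_sym m x) (metric_sym m' z) (metric_sym w m') (metric_sym w z).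
by clear c0 c1 cd; move=> [] ? [] ?; lra.
Qed.

Lemma axis_power g gam : is_axis act delta g gam ->
  exists n, (0 < n)%N /\ 10 * delta <= displacement act (g ^+ n)%g /\ geodesic_orbit act (g ^+ n)%g gam.
Proof.
by move=> [[h1 h2]|[_ [n [n0 h1 h2]]]]; [exists 1%N; rewrite expg1|exists n].
Qed.

(** By [axis_gp], a x is near the orbit path of h. A discrete intermediate value argument finds the
    translate of [x, h x] at its level, and y is the point there as far from the end P as a x is, up
    to a bounded error. *)
Lemma axis_near h x c (gam : set X) a : 10 * delta <= displacement act h ->
  mdist x (act h x) = displacement act h -> geodesic_segment x (act h x) c ->
  gam = [set y | exists k t, [/\ cyclic_subgroup h k,
                 t \in `[0, displacement act h] & y = act k (c t)]] ->
  commute h a -> exists2 y, gam y & mdist y (act a x) <= 13 * (2 * delta).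
Proof.
move=> L_ge xL geo gamE ha.
have [act1 actM actd] := act_isom; have Hd := mdist_hyp; have de0 := delta_gt0.
have h_gp := displacement_gp L_ge xL geo.
set L := displacement act h in L_ge xL gamE *; set D := 2 * delta in h_gp Hd *.
have D0 : 0 < D by rewrite mulr_gt0.
have dh := orbit_hyp x; have dl := @orbit_dL x.
have hl : d x 1%g h = L by rewrite orbit_d1.
have h_len : 2 * D + 3 * D <= d x 1%g h by rewrite hl /D; lra.
have h_len2 : 2 * D + 2 * D <= d x 1%g h by lra.
have [M1 HM1] := axis_gp dh D0 dl h_gp h_len (d x 1%g a).
have [M2 HM2] := pow_unbounded dh D0 dl h_gp h_len (d x 1%g a + 6 * D).
set M := maxn 1 (maxn M1 M2).
have M0 : (0 < M)%N by apply: leq_maxl.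
have axis := HM1 M ltac:(by rewrite /M !leq_max leqnn orbT).
have lM := HM2 M ltac:(by rewrite /M !leq_max leqnn !orbT).
have pgp := pow_gp dh D0 dl h_gp h_len2.
pose P := (h ^- M)%g; pose Q := (h ^+ M)%g; pose Y i := (P * h ^+ i)%g.
have Ta : dgp (d x) a P Q <= 6 * D.
  have -> : 6 * D = 2 * D + 4 * D by lra.
  by apply: axis => //; left; exact: esym ha.
have YP : Y 0%N = P by rewrite /Y expg0 mulg1.
have YQ : Y (M + M)%N = Q by rewrite /Y expgnDr mulKg.
have Ygp i j k : (i <= j)%N -> (j <= k)%N -> dgp (d x) (Y j) (Y i) (Y k) <= 4 * D.
  move=> ij jk; have -> : 4 * D = 2 * D + 2 * D by lra.
  by rewrite (gpL dl); exact: pgp.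
have rQ : d x P a <= d x P Q.
  move: Ta; rewrite /dgp; have := dist_tri dh 1%g a Q.
  by rewrite (distC dh a Q) -/Q; rewrite -/Q in lM; lra.
have r0 : d x P (Y 0%N) <= d x P a by rewrite YP (distxx dh) (dist_ge0 dh).
have {}rQ : d x P a <= d x P (Y (M + M)%N) by rewrite YQ.
have MM : (0 < M + M)%N by rewrite addn_gt0 M0.
have [i iM /andP[ri rSi]] := @discrete_ivt R (fun i => d x P (Y i)) _ _ r0 rQ MM.
have YY : d x (Y i) (Y i.+1) = L by rewrite /Y dl expgSr (distM dl) hl.
pose t := d x P a - d x P (Y i).
have t0 : 0 <= t by rewrite /t subr_ge0.
have tL : t <= L by have := dist_tri dh P (Y i) (Y i.+1); rewrite YY /t; lra.
have [c0 c1 cd] := geo.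
pose y := act (Y i) (c t).
have int : t \in `[0, mdist x (act h x)] by rewrite in_itv /= xL t0 tL.
have in0 : 0 \in `[0, mdist x (act h x)] by rewrite in_itv /= lexx xL (le_trans t0).
have inL : L \in `[0, mdist x (act h x)] by rewrite in_itv /= xL lexx (le_trans t0).
have Yy : mdist (act (Y i) x) y = t.
  by rewrite /y actd -[X in mdist X _]c0 cd // distrC subr0 ger0_norm.
have yY : mdist y (act (Y i.+1) x) = L - t.
  have -> : act (Y i.+1) x = act (Y i) (act h x) by rewrite -actM /Y expgSr mulgA.
  by rewrite /y actd -c1 xL cd // distrC ger0_norm // subr_ge0.
exists y.
  rewrite gamE /=; exists (Y i), t; split => //.
    by rewrite /Y; apply: cyclic_subgroupM; [exists M; right|exists i; left].
  by rewrite in_itv /= t0 tL.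
have g1 : dgp mdist (act (Y i) x) (act P x) (act (Y i.+1) x) <= 4 * D.
  by have := Ygp 0%N i i.+1 isT (leqnSn i); rewrite YP.
have g2 : dgp mdist (act (Y i.+1) x) (act P x) (act Q x) <= 4 * D.
  by have := Ygp 0%N i.+1 (M + M)%N isT iM; rewrite YP YQ.
have g0 : dgp mdist y (act (Y i) x) (act (Y i.+1) x) = 0.
  rewrite /dgp Yy (metric_sym _ y) yY; move: YY; rewrite /orbit_dist => ->; lra.
have gy : dgp mdist y (act P x) (act Q x) <= 8 * D.
  have := gp_nest Hd (act P x) (act Q x) (act (Y i) x) (act (Y i.+1) x) y.
  by rewrite g0; lra.
have ga : dgp mdist (act a x) (act P x) (act Q x) <= 8 * D.
  by apply: le_trans (_ : 6 * D <= _); [exact: Ta|lra].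
have t1 := metric_triangle (act P x) (act (Y i) x) y.
have t2 := metric_triangle (act P x) y (act (Y i.+1) x).
have -> : 13 * D = 4 * D + 8 * D + D by lra.
move: g1; rewrite /dgp (metric_sym (act (Y i.+1) x)).
move: YY rSi ri tL t0; rewrite /t /orbit_dist => YY *.
by apply: (gp_near Hd gy ga); rewrite Yy yY /t /orbit_dist in t1 t2; lra.
Qed.

(** The exponent n for which g^n carries the axis is not controlled by F. A long power g^j with j
    bounded comes from WPD itself, and [commuting_gp] limits its backtracking. *)
Lemma wpd_power (F : R -> R) e : (forall r, 0 < r -> 0 < F r) -> 0 < e ->
  exists K N, forall g, wpd_elt act delta F g -> exists x j, [/\ (j <= K)%N,
    dgp (d x) 1%g (g ^+ j)^-1%g (g ^+ j)%g <= 15 * (2 * delta),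
    200 * (2 * delta) <= d x 1%g (g ^+ j)%g
    & card_le (coarse_stab (d x) e 1%g (g ^+ j)%g) N].
Proof.
move=> F_gt0 e_gt0; have de0 := delta_gt0; pose D := 2 * delta.
have D0 : 0 < D by rewrite mulr_gt0.
(* 217 D is 200 D plus the 17 D lost in [pow_lenD]. An element moving a x by at most e moves a point
   within 13 D of a x by at most e + 26 D. *)
pose r1 := 217 * D; pose r2 := e + 26 * D.
have r10 : 0 < r1 by rewrite /r1; lra.
have r20 : 0 < r2 by rewrite /r2; lra.
pose N1 := Num.truncn (F r1); pose N2 := Num.truncn (F r2).
exists (N1 * N2.+2)%N, N2 => g [g_hyp [gam gam_axis wpd]].
have [n [n0 [L_ge [x [c [xL geo gamE]]]]]] := axis_power gam_axis.
set h := (g ^+ n)%g in L_ge xL geo gamE.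
have l0 : 0 < translation_length act g := g_hyp.
set lam := translation_length act g in wpd l0.
have dh := orbit_hyp x; have dl := @orbit_dL x; rewrite -/D in dh.
have h_gp := displacement_gp L_ge xL geo.
have hl : 5 * D <= d x 1%g h by rewrite orbit_d1 xL /D; lra.
have comm j : commute h (g ^+ j)%g by exact: commuteX2.
have pow_gp15 j : dgp (d x) 1%g (g ^+ j)^-1%g (g ^+ j)%g <= 15 * D.
  exact: commuting_gp dh D0 dl h_gp hl (comm j).
have [act1 actM _] := act_isom.
have L0 : 0 <= displacement act h by lra.
have in_gam k : cyclic_subgroup h k -> gam (act k x).
  move=> hk; rewrite gamE /=; exists k, 0; split => //.
    by rewrite in_itv /= lexx.
  by have [-> _ _] := geo.
have x_gam : gam x.
  by rewrite -(act1 x); apply: in_gam; exists 0%N; left; rewrite expg0.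
(* Otherwise the N1 + 1 distinct elements g^j, j <= N1, move x by at most r1 and, commuting with h,
   also a far point of the axis, against WPD. *)
have [i iN i_far] : exists2 i, (i <= N1)%N & r1 < d x 1%g (g ^+ i)%g.
  apply: contrapT => near.
  have [M0 HM] := pow_unbounded dh D0 dl h_gp (ltac:(lra) : 2 * D + 3 * D <= d x 1%g h) (F r1 * lam).
  have y_far := HM M0 (leqnn M0); rewrite orbit_d1 in y_far.
  have y_gam : gam (act (h ^+ M0)%g x) by apply: in_gam; exists M0; left.
  have [Afin Acard] := wpd r1 r10 x _ x_gam y_gam (ltW y_far).
  have [|j [k [jk _ jkE]]] :=
    card_le_pigeonhole (f := fun j => (g ^+ j)%g) (card_le_fset Afin Acard).
    move=> j jN; have jx : mdist (act (g ^+ j)%g x) x <= r1.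
      rewrite metric_sym -orbit_d1 leNgt; apply/negP => far; apply: near.
      by exists j.
    split => //; rewrite -actM.
    have -> : (g ^+ j * h ^+ M0 = h ^+ M0 * g ^+ j)%g.
      by apply: commute_sym; apply: commute_sym; apply: commuteX; apply: commute_sym.
    by have [_ _ actd] := act_isom; rewrite actM actd.
  exact: (hyperbolic_elt_inj x g_hyp jk jkE).
set f := (g ^+ i)%g in i_far.
have f_len : 15 * D + 2 * D <= d x 1%g f by move: i_far; rewrite /r1; lra.
have f_gp : dgp (d x) 1%g f^-1%g f <= 15 * D by exact: pow_gp15.
exists x, (i * N2.+2)%N; split; first by rewrite leq_mul2r iN orbT.
- exact: pow_gp15.
- rewrite expgnA -/f; have := pow_lenD dh D0 dl f_gp f_len 1 N2.+1.
  rewrite add1n expg1; have := dist_ge0 dh 1%g (f ^+ N2.+1)%g.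
  by move: i_far; rewrite /r1 -/D; lra.
set a := (g ^+ (i * N2.+2))%g.
(* The factor f^(N2+1) is a power of g with exponent at least N2 + 1 > F r2, which gives the first
   term; one more f gives 200 D. *)
have a_far : F r2 * lam + 200 * D <= d x 1%g a.
  have aE : a = (f ^+ (1 + N2.+1))%g by rewrite /a expgnA.
  have := pow_lenD dh D0 dl f_gp f_len 1 N2.+1; rewrite -aE expg1.
  have i0 : (0 < i)%N.
    case: posnP => // i0; move: i_far; rewrite /f i0 expg0 (distxx dh) /r1; lra.
  have : F r2 * lam <= d x 1%g (f ^+ N2.+1)%g.
    rewrite -expgnA; apply: le_trans _ (translation_length_le x _ g_hyp).
    rewrite mulrC; apply: ler_wpM2l; first exact: ltW.
    have /andP[_ FN2] := truncn_itv (ltW (F_gt0 _ r20)).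
    by apply: le_trans (ltW FN2) _; rewrite ler_nat leq_pmull.
  by move: i_far; rewrite /r1; lra.
have [y y_gam ay] := axis_near L_ge xL geo gamE (comm (i * N2.+2)%N).
rewrite -/a -/D in ay.
have xy : F r2 * lam <= mdist x y.
  have := metric_triangle x y (act a x); rewrite -orbit_d1; lra.
have [Afin Acard] := wpd r2 r20 x y x_gam y_gam xy.
apply: card_le_sub (card_le_fset Afin Acard) => k [k1 k2].
have kx : mdist (act k x) x <= e.
  by move: k1; rewrite mulg1 orbit_d1 metric_sym.
split => /=; first by rewrite /r2; lra.
have [_ _ actd] := act_isom.
have t1 := metric_triangle (act k y) (act k (act a x)) y.
have t2 := metric_triangle (act k (act a x)) (act a x) y.
have e1 := actd k y (act a x); have e2 := metric_sym (act a x) y.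
move: k2; rewrite /orbit_dist actM (metric_sym (act a x)) => k2.
by rewrite /r2; lra.
Qed.

End Axes.

(** * Growth *)

Lemma bernoulli (R : realType) (x : R) n : 0 <= x -> 1 + x * n%:R <= (1 + x) ^+ n.
Proof.
move=> x0; elim: n => [|n IH]; first by rewrite mulr0 addr0 expr0.
rewrite exprS -natr1.
have : (1 + x) * (1 + x * n%:R) <= (1 + x) * (1 + x) ^+ n.
  by apply: ler_wpM2l => //; lra.
have : 0 <= x * x * n%:R by rewrite !mulr_ge0.
by lra.
Qed.

(** The limit is the infimum l of the roots u n. For y > l, take m with u m < y; division of n by m
    gives beta n <= B (u m)^n with B constant, which y^n eventually exceeds. *)
Lemma fekete (R : realType) (beta : nat -> nat) : (forall n, (0 < beta n)%N) ->
  (forall m n, (beta (m + n) <= beta m * beta n)%N) ->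
  exists l : R, [/\ (fun n => (beta n)%:R `^ n%:R^-1) @ \oo --> l, 1 <= l,
    forall m, l ^+ m <= (beta m)%:R
    & forall y, l < y -> exists n0, forall n, (n0 <= n)%N -> (beta n)%:R <= y ^+ n].
Proof.
move=> beta_gt0 beta_mul.
pose u n : R := (beta n)%:R `^ n%:R^-1.
have uX n : (0 < n)%N -> u n ^+ n = (beta n)%:R.
  move=> n0; rewrite -powR_mulrn ?powR_ge0 // -powRrM mulVf ?powRr1 //.
  by rewrite pnatr_eq0 -lt0n.
have u0 n : 0 <= u n by exact: powR_ge0.
have beta1 n : 1 <= (beta n)%:R :> R by rewrite ler1n.
have u1 n : (0 < n)%N -> 1 <= u n.
  by move=> n0; rewrite -(@ler_pXn2r _ n) ?nnegrE // expr1n uX.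
pose E := [set u n | n in [set n | (0 < n)%N]].
have Elb : lbound E 1 by move=> _ [n n0 <-]; exact: u1.
have Einf : has_inf E by split; [exists (u 1%N), 1%N|exists 1].
pose l := inf E.
have l1 : 1 <= l by apply: lb_le_inf => //; case: Einf.
have lu n : (0 < n)%N -> l <= u n.
  by move=> n0; apply: ge_inf; [exists 1|exists n].
have ev y : l < y -> exists n0, forall n, (n0 <= n)%N -> (beta n)%:R <= y ^+ n.
  move=> ly; have e0 : 0 < (y - l) / 2 by lra.
  have [_ [m m0 <-] um] := inf_adherent e0 Einf; rewrite -/l in um.
  have uXm := uX m m0; have y1_ge1 := u1 m m0.
  set y1 := u m in um uXm y1_ge1.
  have y1y : y1 < y by lra.
  pose B := (\sum_(r < m) beta r)%N.
  have x0 : 0 < y / y1 - 1 by rewrite subr_gt0 ltr_pdivlMr; lra.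
  exists (Num.bound (B%:R / (y / y1 - 1))) => n nn.
  have key : (beta n)%:R <= B%:R * y1 ^+ n.
    apply: (@le_trans _ _ (((beta (n %% m)) * beta m ^ (n %/ m))%N%:R)).
      rewrite ler_nat {1}(divn_eq n m).
      elim: (n %/ m)%N => [|q IH]; first by rewrite mul0n expn0 muln1 add0n.
      rewrite mulSn -addnA expnS mulnCA; apply: leq_trans (beta_mul _ _) _.
      by rewrite leq_mul2l IH orbT.
    rewrite natrM; apply: ler_pM => //.
      rewrite ler_nat /B (bigD1 (Ordinal (ltn_pmod n m0))) //=; exact: leq_addr.
    rewrite natrX -uXm -exprM; apply: ler_weXn2l => //.
    by rewrite mulnC; exact: leq_trunc_div.
  apply: le_trans key _.
  have y10 : 0 < y1 by lra.
  have -> : y ^+ n = (1 + (y / y1 - 1)) ^+ n * y1 ^+ n.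
    by rewrite -exprMn addrC subrK divfK // gt_eqF.
  rewrite ler_wpM2r ?exprn_ge0 ?(ltW y10) //.
  apply: le_trans (bernoulli n (ltW x0)).
  have : B%:R <= (y / y1 - 1) * n%:R.
    rewrite mulrC -ler_pdivrMr //; apply: ltW; apply: lt_le_trans (archi_boundP _) _.
      by rewrite divr_ge0 // ltW.
    by rewrite ler_nat.
  by lra.
exists l; split => //.
- apply/cvgrPdist_le => e e0.
  have [n0 Hn0] := ev (l + e) ltac:(lra).
  exists (maxn 1 n0) => // n /=; rewrite geq_max => /andP[n1 nn0].
  rewrite distrC ger0_norm ?subr_ge0 ?lu // lerBlDl.
  rewrite -(@ler_pXn2r _ n) ?nnegrE //; first by rewrite uX // Hn0.
  by lra.
- case=> [|m]; first by rewrite expr0.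
  rewrite -uX // ler_pXn2r ?nnegrE //; [exact: lu|by lra].
Qed.

Section Growth.
Context {R : realType} {G : groupType}.
Variable S : set G.
Hypothesis S_gen : finite_generating_set S.

Lemma in_ball n g : (g \in fset_set (word_ball S n)) = (g \in word_ball S n).
Proof. by rewrite in_fset_set //; exact: word_ball_finite. Qed.

Lemma ball_size_gt0 n : (0 < ball_size S n)%N.
Proof.
rewrite cardfs_gt0; apply/fset0Pn; exists 1%g.
by rewrite in_ball; apply/mem_set/word_ball_one.
Qed.

Lemma word_ball_split m n g : word_ball S (m + n) g ->
  exists x y, [/\ word_ball S m x, word_ball S n y & g = (x * y)%g].
Proof.
move=> [s [smn sS ->]].
exists (\prod_(a <- take m s) a)%g, (\prod_(a <- drop m s) a)%g; split.
- exists (take m s); split => //; first by rewrite size_take; case: ltnP.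
  by move=> x /mem_take/sS.
- exists (drop m s); split => //; first by rewrite size_drop leq_subLR.
  by move=> x /mem_drop/sS.
- by rewrite -big_cat cat_take_drop.
Qed.

Lemma ball_size_mul m n : (ball_size S (m + n) <= ball_size S m * ball_size S n)%N.
Proof.
rewrite /ball_size -(size_allpairs (fun x y => x * y)%g).
apply: uniq_leq_size => // g; rewrite in_ball => /set_mem.
move=> /word_ball_split[x [y [xm yn ->]]]; apply/allpairsP; exists (x, y).
by split => //; rewrite in_ball; apply/mem_set.
Qed.

Lemma growth_rateP : let l := growth_rate R S in
  [/\ 1 <= l, forall m, l ^+ m <= (ball_size S m)%:R
    & forall y, l < y -> exists n0, forall n, (n0 <= n)%N -> (ball_size S n)%:R <= y ^+ n].
Proof.
have [l [cvg_l l1 l2 l3]] := fekete R ball_size_gt0 ball_size_mul.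
by rewrite /growth_rate -[limn _]/(lim _) (cvg_lim _ cvg_l).
Qed.

(** Iteration gives |B_m|^j <= K^j |B_(j (m + b))|; for j large the last ball has at most y^(j (m +
    b)) elements, and j-th roots are taken. *)
Lemma ball_size_growth K b m y : (0 < b)%N ->
  (forall n, (ball_size S m * ball_size S n <= K * ball_size S (m + n + b))%N) ->
  growth_rate R S < y -> (ball_size S m)%:R <= K%:R * y ^+ (m + b).
Proof.
move=> b0 H ly; have [l1 _ /(_ y ly)[n0 Hn0]] := growth_rateP.
have y0 : 0 <= y by lra.
have pow j : (ball_size S m ^ j <= K ^ j * ball_size S (j * (m + b)))%N.
  elim: j => [|j IH]; first by rewrite !expn0 mul1n mul0n ball_size_gt0.
  rewrite !expnS; apply: (@leq_trans (ball_size S m * (K ^ j * ball_size S (j * (m + b))))%N).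
    by rewrite leq_mul2l IH orbT.
  rewrite mulnCA (mulnC K) -mulnA leq_mul2l; apply/orP; right.
  by have := H (j * (m + b))%N; rewrite mulSn addnAC.
have := pow n0.+1; rewrite -(ler_nat R) natrM !natrX => h.
rewrite -(@ler_pXn2r _ n0.+1) ?nnegrE // ?mulr_ge0 ?exprn_ge0 //.
apply: le_trans h _; rewrite exprMn ler_wpM2l ?exprn_ge0 // -exprM (mulnC (m + b)%N).
by apply: Hn0; apply: (@leq_trans n0.+1) => //; rewrite leq_pmulr // addn_gt0 b0 orbT.
Qed.

End Growth.

(** * Equations *)

Section Words.
Context {G : groupType} {l : nat}.
Implicit Types (t : l.-tuple G).

Definition letter_value t (a : 'I_l * bool) : G :=
  if a.2 then tnth t a.1 else (tnth t a.1)^-1%g.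

Definition positive_value t (w : seq 'I_l) : G := (\prod_(i <- w) tnth t i)%g.

(** As [free_group] contains reduced words only, each new letter either cancels the head or is put
    in front of it. *)
Lemma free_reduction (s : seq ('I_l * bool)) : exists r : free_group l,
  forall t, eval_word r t = (\prod_(a <- s) letter_value t a)%g.
Proof.
elim: s => [|a s [[r r_red] IH]].
  by exists (exist _ [::] isT) => t; rewrite /eval_word !big_nil.
case: r r_red IH => [|b r] r_red IH.
  exists (exist _ [:: a] isT) => t; rewrite big_cons -IH /eval_word /=.
  by rewrite big_seq1 big_nil mulg1.
case: (boolP ((a.1 == b.1) && (a.2 != b.2))) => ab.
  exists (exist _ r (path_sorted r_red)) => t; rewrite big_cons -IH /eval_word /=.
  rewrite big_cons mulgA /letter_value; have /andP[/eqP -> ab2] := ab.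
  by move: ab2; case: a.2; case: b.2 => // _; rewrite ?mulgV ?mulVg mul1g.
have r' : reduced_word (a :: b :: r) by rewrite /reduced_word /= ab.
exists (exist (fun w : seq ('I_l * bool) => reduced_word w) (a :: b :: r) r') => t.
by rewrite big_cons -IH /eval_word /= big_cons.
Qed.

Lemma word_equation (w w' : seq 'I_l) : exists r : free_group l,
  forall t, eval_word r t = 1%g <-> positive_value t w = positive_value t w'.
Proof.
have [r hr] := free_reduction
  ([seq (i, true) | i <- w] ++ [seq (i, false) | i <- seq.rev w']).
exists r => t; rewrite hr big_cat !big_map /=.
have -> : (\prod_(i <- seq.rev w') letter_value t (i, false) = (positive_value t w')^-1)%g.
  rewrite /positive_value; elim: w' {hr} => [|i w' IH].
    by rewrite !big_nil invg1.
  by rewrite rev_cons -cats1 big_cat IH big_seq1 big_cons invgM.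
rewrite -[X in (X * _)%g]/(positive_value t w).
by split => [/divg1_eq|->]; rewrite ?mulgV.
Qed.

Variables (S : set G) (t : l.-tuple G) (i1 : 'I_l).
Hypothesis t_one : tnth t i1 = 1%g.
Hypothesis t_S : forall i, S (tnth t i) \/ tnth t i = 1%g.
Hypothesis S_t : forall s, S s -> exists i, tnth t i = s.

(** The entry 1 of the tuple pads shorter words to length exactly m. *)
Lemma word_ballP m g :
  word_ball S m g <-> exists w : m.-tuple 'I_l, positive_value t w = g.
Proof.
split; last first.
  move=> [w <-]; rewrite /positive_value -{1}(size_tuple w).
  elim: (w : seq _) => [|i s IH]; first by rewrite big_nil; apply: word_ball_one.
  rewrite big_cons /= -add1n; apply: word_ball_mul => //.
  case: (t_S i) => [/word_ball_letter //|->]; exact: word_ball_one.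
move=> [s [sm sS ->]].
suff [w wm <-] : exists2 w : seq 'I_l, size w = m & positive_value t w = (\prod_(a <- s) a)%g.
  by have wm' : size w == m by [apply/eqP]; exists (Tuple wm').
rewrite /positive_value; elim: m s sm sS => [|m IH] [|x s] // sm sS.
- by exists [::] => //; rewrite !big_nil.
- have [//|w wm we] := IH [::] isT.
  by exists (i1 :: w); rewrite /= ?wm // big_cons we t_one mul1g.
have [|w wm we] := IH s sm; first by move=> y ys; apply: sS; rewrite in_cons ys orbT.
have [i ti] := S_t (sS x (mem_head _ _)).
by exists (i :: w); rewrite /= ?wm // !big_cons we ti.
Qed.

End Words.

(** Choosing a word for each element of the ball of S and evaluating it in t' is injective by the
    last hypothesis. *)
Lemma ball_size_le_words (G : groupType) (l m : nat) (S S' : set G) (t t' : l.-tuple G)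
    (i1 i1' : 'I_l) :
  finite_generating_set S -> finite_generating_set S' ->
  tnth t i1 = 1%g -> tnth t' i1' = 1%g ->
  (forall i, S (tnth t i) \/ tnth t i = 1%g) ->
  (forall i, S' (tnth t' i) \/ tnth t' i = 1%g) ->
  (forall s, S s -> exists i, tnth t i = s) ->
  (forall s, S' s -> exists i, tnth t' i = s) ->
  (forall w w' : m.-tuple 'I_l, positive_value t' w = positive_value t' w' ->
     positive_value t w = positive_value t w') ->
  (ball_size S m <= ball_size S' m)%N.
Proof.
move=> Sg Sg' t1 t1' tS tS' St St' H.
have ballP := word_ballP t1 tS St m; have ballP' := word_ballP t1' tS' St' m.
have /choice[w Hw] : forall g, exists w : m.-tuple 'I_l,
    word_ball S m g -> positive_value t w = g.
  move=> g; have [/ballP[w <-]|ng] := pselect (word_ball S m g); first by exists w.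
  by exists [tuple i1 | _ < m].
pose f g := positive_value t' (w g).
rewrite /ball_size -(size_map f (fset_set (word_ball S m))).
apply: uniq_leq_size.
  rewrite map_inj_in_uniq; first exact: fset_uniq.
  move=> g g'; rewrite !in_ball // => /set_mem hg /set_mem hg' e.
  by rewrite -(Hw g hg) -(Hw g' hg'); apply: H.
move=> _ /mapP[g _ ->]; rewrite in_ball //; apply/mem_set/ballP'.
by exists (w g).
Qed.

Lemma finite_filter_forall (T I : choiceType) (F : set_system T) (A : set I) (P : I -> set T) :
  Filter F -> finite_set A -> (forall i, A i -> F (P i)) ->
  F [set x | forall i, A i -> P i x].
Proof.
move=> FF /finite_seqP[s ->]; elim: s => [|i s IH] H.
  by apply: filterS filterT => x _ i.
have h1 := H i (mem_head _ _).
have h2 : F [set x | forall j, [set` s] j -> P j x].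
  by apply: IH => j js; apply: H; rewrite /= in_cons orbC js.
apply: filterS (filterI h1 h2) => x [x1 x2] j /=; rewrite in_cons => /orP[/eqP->//|js].
exact: x2.
Qed.

(* Along an ultrafilter, the words that are trivial almost surely form a system
   of equations; by finiteness of an equivalent subsystem, some term of the
   sequence satisfies all of them. *)
Lemma noetherian_dominating (G : groupType) (l : nat) (S : nat -> set G) (t : nat -> l.-tuple G)
    (i1 : 'I_l) : equationally_noetherian G ->
  (forall n, finite_generating_set (S n)) ->
  (forall n, tnth (t n) i1 = 1%g) ->
  (forall n i, S n (tnth (t n) i) \/ tnth (t n) i = 1%g) ->
  (forall n s, S n s -> exists i, tnth (t n) i = s) ->
  exists N, forall m, exists2 n, (N < n)%N & (ball_size (S N) m <= ball_size (S n) m)%N.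
Proof.
move=> noeth Sg t1 tS St.
have [U [U_ultra UF]] := ultraFilterLemma (F := \oo) _.
pose K := [set r : free_group l | U [set n | eval_word r (t n) = 1%g]].
have l0 : (0 < l)%N by apply: leq_ltn_trans (ltn_ord i1).
have [K0 [K0fin K0K K0E]] := noeth l l0 K.
have [N HN] : exists N, solution_set G l K (t N).
  have H : U [set n | forall r, K0 r -> eval_word r (t n) = 1%g].
    apply: (@finite_filter_forall nat _ U K0 (fun r => [set n | eval_word r (t n) = 1%g])) => //.
  have [N HN] := filter_ex H.
  by exists N; rewrite -K0E.
exists N => m.
have /choice[r Hr] : forall ww : m.-tuple 'I_l * m.-tuple 'I_l, exists r : free_group l,
    forall t : l.-tuple G, eval_word r t = 1%g <-> positive_value t ww.1 = positive_value t ww.2.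
  by move=> ww; exact: word_equation.
(* A word outside K is nontrivial in almost all tuples, and there are only finitely many pairs of
   words of length m. *)
have HU : U [set n | forall ww : m.-tuple 'I_l * m.-tuple 'I_l,
    eval_word (r ww) (t n) = 1%g -> K (r ww)].
  apply: filter_forall => ww.
  have [h|h] := in_ultra_setVsetC [set n | eval_word (r ww) (t n) = 1%g] U_ultra.
    by apply: filterS filterT => n _ _.
  by apply: filterS h => n /= hn /hn.
have HN' : U [set n | (N < n)%N] by apply: UF; exists N.+1.
have [n [/= Nn Hn]] := filter_ex (filterI HN' HU).
exists n => //.
apply: (ball_size_le_words (Sg N) (Sg n) (t1 N) (t1 n) (tS N) (tS n) (St N) (St n)).
move=> w w' e; apply/(Hr (w, w')); apply: HN; apply: Hn.
exact/Hr.
Qed.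

(** * Well-ordering of the growth rates *)

Lemma power_beats_linear (R : realType) (q C : R) : 1 < q -> 0 <= C ->
  (forall m : nat, q ^+ m <= C * (20 * m + 1)%N%:R) -> False.
Proof.
move=> q1 C0 H; pose x := q - 1; have x0 : 0 < x by rewrite /x; lra.
(* At exponent 2 k, squaring the Bernoulli bound for q^k gives (x k)^2, which exceeds 41 C k >= C
   (40 k + 1). *)
pose k := (Num.bound (41 * C / (x * x))).+1.
have := H (2 * k)%N; rewrite mulnC exprM.
have b := bernoulli k (ltW x0).
have qE : 1 + x = q by rewrite /x; lra.
rewrite qE in b.
have k1 : 1 <= k%:R :> R by rewrite ler1n.
have b2 : (x * k%:R) * (x * k%:R) <= q ^+ k ^+ 2.
  have xk : 0 <= x * k%:R by rewrite mulr_ge0 // ltW.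
  by rewrite expr2; apply: ler_pM => //; lra.
have kb : 41 * C < k%:R * (x * x).
  rewrite -ltr_pdivrMr ?mulr_gt0 //; apply: lt_le_trans (archi_boundP _) _.
    by rewrite divr_ge0 // ?mulr_ge0 // ltW.
  by rewrite ler_nat.
have kb2 : 41 * C * k%:R < k%:R * (x * x) * k%:R by rewrite ltr_pM2r //; lra.
have C1 : C * (20 * (k * 2) + 1)%N%:R <= C * (41 * k%:R).
  by apply: ler_wpM2l => //; rewrite natrD !natrM; lra.
by rewrite (mulnC k 2) in C1 *; lra.
Qed.

(** The bounds K and N of [wpd_power] are chosen before S, and they determine, with M, the lengths
    of a and of the separator. *)
Lemma uniform_ball_product (R : realType) (G : groupType) (X : metricType R)
    (act : G -> X -> X) (delta : R) (F : R -> R) (M : nat) :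
  0 < delta -> gromov_hyperbolic X delta -> isometric_action act ->
  ~ virtually_cyclic G -> (forall r : R, 0 < r -> 0 < F r) ->
  (forall S : set G, finite_generating_set S ->
     exists2 g : G, word_ball S M g & wpd_elt act delta F g) ->
  exists C b, (0 < b)%N /\ forall S : set G, finite_generating_set S -> forall m n,
    (ball_size S m * ball_size S n <= (C * (20 * m + 1)) * ball_size S (m + n + b))%N.
Proof.
move=> delta0 X_hyp act_isom G_nvc F0 short.
pose D := 2 * delta; have D0 : 0 < D by rewrite mulr_gt0.
have e0 : 0 < 3 * (440 * D) + 18 * D + D by lra.
have [K [N HK]] := wpd_power delta0 X_hyp act_isom F0 e0.
exists (4 * N)%N, (2 * (sep_exp N * (4 * (K * M) + 2)) + 1)%N.
split=> [|S Sg m n]; first by rewrite addn1.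
have [g gM g_wpd] := short S Sg.
have [x [j [jK a_gp a_len aN]]] := HK g g_wpd.
have gw : word_ball S (K * M) (g ^+ j)%g.
  by apply: word_ball_leq (word_ball_exp j gM); rewrite leq_mul2r jK orbT.
have [d [d_hyp dL [a [aw a_good S_len]]]] :=
  good_adapted (orbit_hyp act X_hyp x) D0 (orbit_dL act_isom x) Sg gw a_gp a_len aN.
have [s Ss s_nc] : exists2 s, S s & ~ commensurates a s.
  apply: contrapT => h; apply: G_nvc.
  apply: (commensurated_virtually_cyclic d_hyp D0 dL a_good Sg) => s Ss.
  by apply: contrapT => s_nc; apply: h; exists s.
have := ball_product d_hyp D0 dL Sg a_good aw Ss s_nc S_len m n.
by rewrite mulnA (mulnAC 4 _ N).
Qed.

Lemma decreasing_sequence (R : realType) (A : set R) (x0 : R) : A x0 ->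
  (forall x, A x -> exists2 y, A y & y < x) ->
  exists u : nat -> R, (forall n, A (u n)) /\ forall m n, (m < n)%N -> u n < u m.
Proof.
move=> Ax0 Alt.
have /choice[f Hf] : forall x, exists y, A x -> A y /\ y < x.
  move=> x; have [Ax|nAx] := pselect (A x); last by exists x.
  by have [y Ay yx] := Alt x Ax; exists y.
pose u n := iter n f x0.
have uA n : A (u n) by elim: n => [//|n IH]; exact: (Hf _ IH).1.
exists u; split => // m; elim=> // n IH; rewrite ltnS leq_eqVlt => /orP[/eqP->|mn].
  exact: (Hf _ (uA n)).2.
by apply: lt_trans (IH mn); exact: (Hf _ (uA n)).2.
Qed.

(** Padding with 1 gives generating sets of different sizes tuples of one common length. *)
Lemma generating_tuple (G : groupType) (S : set G) (l : nat) :
  finite_generating_set S -> (ball_size S 1 <= l)%N ->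
  exists t : l.+1.-tuple G, [/\ tnth t ord0 = 1%g,
    forall i, S (tnth t i) \/ tnth t i = 1%g
    & forall s, S s -> exists i, tnth t i = s].
Proof.
move=> Sg Sl; pose ss : seq G := fset_set S.
have [Sfin _ _] := Sg.
have ssE s : (s \in ss) = (s \in S) by rewrite in_fset_set.
have lss : (size ss <= l)%N.
  apply: leq_trans Sl; apply: uniq_leq_size; first exact: fset_uniq.
  move=> s; rewrite ssE in_ball // => /set_mem Ss; apply/mem_set.
  exact: word_ball_letter.
exists [tuple nth 1%g (1%g :: ss) i | i < l.+1]; split => [|i|s Ss].
- by rewrite tnth_mktuple.
- rewrite tnth_mktuple; case: i => [[|i] /= il]; first by right.
  case: (ltnP i (size ss)) => iss; last by right; rewrite nth_default.
  by left; apply/set_mem; rewrite -ssE mem_nth.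
have sss : s \in ss by rewrite ssE; apply/mem_set.
have il : ((index s ss).+1 < l.+1)%N by rewrite ltnS (leq_trans _ lss) // index_mem.
by exists (Ordinal il); rewrite tnth_mktuple /= nth_index.
Qed.

Theorem theorem3p1 (R : realType) (G : groupType) (X : metricType R)
    (act : G -> X -> X) (delta : R) (D : R -> R)
    (G_fg : finitely_generated G)
    (delta_gt0 : 0 < delta)
    (X_hyp : gromov_hyperbolic X delta)
    (act_isom : isometric_action act)
    (act_graph : acts_on_metric_graph act)
    (G_nvc : ~ virtually_cyclic G)
    (D_wpd : wpd_function delta D)
    (short_wpd : exists M : nat, forall S : set G, finite_generating_set S ->
       exists g : G,
         [/\ word_ball S M g, hyperbolic_elt act g & wpd_elt act delta D g])
    (G_noeth : equationally_noetherian G) :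
  wochoice.wo_chain <=%R (mem (growth_rates G R)).
Proof.
have [F0 _ _] := D_wpd; have [M short] := short_wpd.
have [|C [b [b0 prod]]] := uniform_ball_product (M := M) delta_gt0 X_hyp act_isom G_nvc F0.
  by move=> S Sg; have [g [gw _ gD]] := short S Sg; exists g.
move=> A A_sub [x0 Ax0].
suff [x Ax x_min] : exists2 x, x \in A & forall y, y \in A -> x <= y.
  exists x; split; first by split.
  by move=> y [Ay y_min]; apply/eqP; rewrite eq_le x_min // y_min.
apply: contrapT => no_min.
have A_lt x : [set` A] x -> exists2 y, [set` A] y & y < x.
  move=> Ax; apply: contrapT => h; apply: no_min; exists x => // y Ay.
  by rewrite leNgt; apply/negP => yx; apply: h; exists y.
have [u [uA u_dec]] := decreasing_sequence (A := [set` A]) Ax0 A_lt.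
have /choice[S HS] : forall n, exists S : set G, finite_generating_set S /\ growth_rate R S = u n.
  move=> n; have /set_mem[S Sg SE] : u n \in growth_rates G R by exact: A_sub (uA n).
  by exists S.
have Sg n := (HS n).1; have SE n := (HS n).2.
have bound n m y : u n < y -> (ball_size (S n) m)%:R <= (C * (20 * m + 1))%:R * y ^+ (m + b).
  move=> uy; apply: (ball_size_growth (Sg n) b0) => [k|]; first exact: prod.
  by rewrite SE.
have u1 n : 1 <= u n by rewrite -SE; have [] := growth_rateP (R := R) (Sg n).
have u_le m n : (m <= n)%N -> u n <= u m.
  by rewrite leq_eqVlt => /orP[/eqP->//|/u_dec/ltW].
(* The number u 0 + 1 exceeds every rate of the sequence, so the bound at m = 1 holds for all n at
   once. *)
pose l := Num.bound ((C * (20 * 1 + 1))%:R * (u 0%N + 1) ^+ (1 + b)).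
have ball_l n : (ball_size (S n) 1 <= l)%N.
  rewrite -(ler_nat R) ltW //.
  apply: le_lt_trans (bound n 1%N (u 0%N + 1) _) _.
    by have := u_le 0%N n (leq0n n); lra.
  by apply: archi_boundP; rewrite mulr_ge0 ?exprn_ge0 //; have := u1 0%N; lra.
have /choice[t Ht] := fun n => generating_tuple (Sg n) (ball_l n).
have t1 n : tnth (t n) ord0 = 1%g by have [] := Ht n.
have tS n i : S n (tnth (t n) i) \/ tnth (t n) i = 1%g by have [] := Ht n.
have St n s : S n s -> exists i, tnth (t n) i = s by have [_ _] := Ht n; apply.
have [N HN] := noetherian_dominating G_noeth Sg t1 tS St.
have uNN := u_dec N N.+1 (ltnSn N).
pose y := (u N + u N.+1) / 2.
have [y1 y2] : y < u N /\ u N.+1 < y by rewrite /y; split; lra.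
have y0 : 0 < y by have := u1 N.+1; lra.
(* Dividing u_N^m <= |B_m(S_N)| <= |B_m(S_n)| <= C (20 m + 1) y^(m+b) by y^m contradicts u_N > y for
   large m. *)
apply: (@power_beats_linear R (u N / y) (C%:R * y ^+ b)).
- by rewrite ltr_pdivlMr // mul1r.
- by rewrite mulr_ge0 ?exprn_ge0 // ltW.
move=> m; have [n Nn ball_le] := HN m.
have [_ /(_ m) low _] := growth_rateP (R := R) (Sg N); rewrite SE in low.
have uy : u n < y by apply: le_lt_trans y2; apply: u_le.
rewrite expr_div_n ler_pdivrMr ?exprn_gt0 //.
apply: le_trans low _; apply: (@le_trans _ _ (ball_size (S n) m)%:R).
  by rewrite ler_nat.
apply: le_trans (bound n m y uy) _.
by rewrite natrM exprD (mulrC (y ^+ m)) !mulrA (mulrAC C%:R).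
Qed.
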